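(* Let $\tau_1,\tau_2\in(0,1]$, and let $L=\alpha_1\cup\alpha_2$ be the weighted clasp configuration of the generalized link $C(\tau_1,\tau_2)$ defined in the context (two clasped arcs in the perpendicular planes $P_1,P_2$, with explicit shapes given by $X_i,Z_i,h$). Then $L$ is strongly critical for minimizing the weighted length $\mathrm{Len}^w(L)=w_1\,\mathrm{Len}(\alpha_1)+w_2\,\mathrm{Len}(\alpha_2)$ with weights $w_i=1/\tau_i$, when constrained by Gehring thickness.
   Context: GENERALIZED LINKS AND CRITICALITY. A generalized link $L$ is a curve in $\mathbb{R}^3$ with finitely many, mutually disjoint components $L_i$ (arcs or closed curves), where each endpoint $x\in\partial L$ is constrained to stay on a given affine subspace $M_x\subset\mathbb{R}^3$, together with finitely many obstacles $\{p\in\mathbb{R}^3: g_j(p)<0\}$, with $g_j$ of class $C^1$ having $0$ as a regular value; $L$ must lie in $\{\min_j g_j\ge 0\}$. The Gehring thickness $\mathrm{GThi}(L)$ is the minimal distance between points on different components of $L$. The Gehring ropelength problem is to minimize (weighted) length subject to $\mathrm{GThi}\ge1$. A Gehring strut is an unordered pair $\{x,y\}$ of points on different components with $|x-y|=\mathrm{GThi}(L)$; a wall strut is a pair $(j,x)$ with $x\in L$, $g_j(x)=0$. A compatible vectorfield is a continuous $\xi:L\to\mathbb{R}^3$ (continuous along the parametrized curve) with $\xi_x$ tangent to $M_x$ at each endpoint $x$. The first variation of length of a component with unit tangent $T$ (of bounded variation) is $\delta_\xi\mathrm{Len}=[T\cdot\xi]_{\mathrm{start}}^{\mathrm{end}}-\int\xi\cdot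 dT$ (no boundary term for closed components), and $\delta_\xi\mathrm{Len}^w=\sum_i w_i\,\delta_\xi\mathrm{Len}(L_i)$ for weights $w_i\ge0$. Put $\delta^+_\xi\mathrm{GThi}(L)=\min (\xi_x-\xi_y)\cdot\frac{x-y}{|x-y|}$ over all Gehring struts $\{x,y\}$, and $\delta^+_\xi O(L)=\min \xi_x\cdot\nabla g_j(x)$ over all wall struts $(j,x)$; these are the one-sided first variations of $\mathrm{GThi}$ and of $O(L)=\min_j\min_{x\in L}g_j(x)$. $L$ is strongly critical for minimizing $\mathrm{Len}^w$ when constrained by $\mathrm{GThi}$ if there is $\varepsilon>0$ such that for all compatible $\xi$ with $\delta_\xi\mathrm{Len}^w=-1$ we have $\min(\delta^+_\xi\mathrm{GThi}(L),\delta^+_\xi O(L))\le-\varepsilon$. WEIGHTED CLASP ARCS. Use coordinates $(x_1,x_2,z)$ on $\mathbb{R}^3$ with $z$ vertical, and let $P_i$ be the $x_iz$-coordinate plane. Given $\tau_1,\tau_2\in(0,1]$, for $\{i,j\}=\{1,2\}$ and $u\in[0,\tau_i]$ set $v=\tau_j(1-u/\tau_i)$ and $$X_i(u)=\sqrt{\frac{u^2(1-v^2)}{1-u^2v^2}},\qquad Z_i(u)=\int_0^u\frac{s}{\sqrt{1-s^2}}\,X_i'(s)\,ds,$$ extended to $[-\tau_i,\tau_i]$ by $X_i(-u)=-X_i(u)$, $Z_i(-u)=Z_i(u)$. Let $h=Z_2(\tau_2)+\sqrt{1-\tau_2^2}=Z_1(\tau_1)+\sqrt{1-\tau_1^2}$.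 Here $|u|$ is the absolute value of the $z$-component of the unit tangent; a point of the first arc below with parameter $|u_1|$ is at distance $1$ from points of the second with parameter $|u_2|$ when $|u_1|/\tau_1+|u_2|/\tau_2=1$. CONFIGURATION. $\alpha_1\subset P_1$ is the arc $\{(X_1(u),0,h-Z_1(u)):|u|\le\tau_1\}$, extended at its two ends $u=\pm\tau_1$ by straight segments in the directions $n_\pm=(\pm\sqrt{1-\tau_1^2},0,-\tau_1)$ until they meet the planes $n_\pm\cdot p=c_1$ respectively. $\alpha_2\subset P_2$ is the arc $\{(0,X_2(u),Z_2(u)):|u|\le\tau_2\}$, extended at its ends $u=\pm\tau_2$ by straight segments in the directions $m_\pm=(0,\pm\sqrt{1-\tau_2^2},\tau_2)$ until they meet the planes $m_\pm\cdot p=c_2$ respectively. Each endpoint $x$ has as constraint $M_x$ the plane just named on which it lies (these planes make angle $\arcsin\tau_i$ with the vertical). The obstacles are given by $g=c_1-n_\pm\cdot p$ and $g=c_2-m_\pm\cdot p$, i.e. $L$ must stay in $T=\{n_\pm\cdot p\le c_1,\ m_\pm\cdot p\le c_2\}$ (a tetrahedron when $\tau_1,\tau_2<1$). The constants $c_1,c_2$ are fixed, and large enough that $\alpha_1\cup\alpha_2\subset T$. The isotopy class of $C(\tau_1,\tau_2)$ is the one for which closing each arc within the planes of its endpoints gives a Hopf link. *)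

(* Defs.v *)
From HB Require Import structures.
From mathcomp Require Import all_boot all_order all_algebra.
From mathcomp Require Import all_classical all_reals all_analysis.

Set Implicit Arguments.
Unset Strict Implicit.
Unset Printing Implicit Defensive.

Import Order.TTheory GRing.Theory Num.Theory.
Import numFieldNormedType.Exports.

Local Open Scope classical_set_scope.
Local Open Scope ring_scope.

(* The library norm on 'rV[R]_3 is the sup norm. It induces the Euclidean
   topology, but distances and directions below are taken with enorm. *)

Definition dot (R : realType) (u v : 'rV[R]_3) : R :=
  \sum_(k < 3) u ord0 k * v ord0 k.

Definition enorm (R : realType) (u : 'rV[R]_3) : R := Num.sqrt (dot u u).

Definition direction (R : realType) (u : 'rV[R]_3) : 'rV[R]_3 :=
  (enorm u)^-1 *: u.

Definition vec3 (R : realType) (x1 x2 z : R) : 'rV[R]_3 :=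
  \row_(k < 3) [:: x1; x2; z]`_k.

Definition grad (R : realType) (g : 'rV[R]_3 -> R) (p : 'rV[R]_3) : 'rV[R]_3 :=
  \row_(k < 3) 'D_(delta_mx ord0 k) g p.

Definition class_C1 (R : realType) (g : 'rV[R]_3 -> R) : Prop :=
  (forall p, differentiable g p) /\ continuous (grad g).

(* The affine subspace p + D, where D is the row space of affine_dir. *)
Record affine_subspace (R : realType) := AffineSubspace {
  affine_base : 'rV[R]_3;
  affine_dir : 'M[R]_3 }.

Definition in_affine (R : realType) (M : affine_subspace R) (p : 'rV[R]_3) :
    Prop :=
  (p - affine_base M <= affine_dir M)%MS.

Definition tangent_to (R : realType) (M : affine_subspace R) (v : 'rV[R]_3) :
    Prop :=
  (v <= affine_dir M)%MS.

(* The plane {p | n . p = c}, for n != 0. *)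
Definition plane (R : realType) (n : 'rV[R]_3) (c : R) : affine_subspace R :=
  AffineSubspace ((c / dot n n) *: n) (kermx n^T).

(* Only the values of cmap on [cstart, cend] matter. The field cends is None
   for a closed curve, and Some (M, M') for an arc whose initial and final
   points are constrained to M and M' respectively. *)
Record component (R : realType) := Component {
  cstart : R;
  cend : R;
  cmap : R -> 'rV[R]_3;
  cends : option (affine_subspace R * affine_subspace R) }.

(* The obstacles are the sets {p | obst j p < 0}. *)
Record glink (R : realType) := GLink {
  ncomp : nat;
  comp : 'I_ncomp -> component R;
  nobst : nat;
  obst : 'I_nobst -> 'rV[R]_3 -> R }.

Definition forward_tangent (R : realType) (c : component R) (t : R) :
    'rV[R]_3 :=
  lim (direction (cmap c s - cmap c t) @[s --> t^'+]).

Definition backward_tangent (R : realType) (c : component R) (t : R) :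
    'rV[R]_3 :=
  lim (direction (cmap c t - cmap c s) @[s --> t^'-]).

(* The right-continuous representative of the oriented unit tangent. It does
   not depend on the parametrization, which need not be differentiable. On a
   closed component the two ends of the parameter interval are the same
   point, so they carry the same tangent. *)
Definition unit_tangent (R : realType) (c : component R) (t : R) : 'rV[R]_3 :=
  if t < cend c then forward_tangent c t
  else if cends c is Some _ then backward_tangent c (cend c)
  else forward_tangent c (cstart c).

Definition has_BV_unit_tangent (R : realType) (c : component R) : Prop :=
  [/\ forall t, cstart c <= t < cend c ->
        cvg (direction (cmap c s - cmap c t) @[s --> t^'+]),
      cvg (direction (cmap c (cend c) - cmap c s) @[s --> (cend c)^'-]),
      forall t, t \in `[cstart c, cend c] -> enorm (unit_tangent c t) = 1 &
      forall k : 'I_3, bounded_variation (cstart c) (cend c)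
        (fun t => unit_tangent c t ord0 k)].

Definition is_component (R : realType) (c : component R) : Prop :=
  [/\ cstart c < cend c,
      {within `[cstart c, cend c], continuous (cmap c)},
      has_BV_unit_tangent c &
      match cends c with
      | Some (M, M') =>
          in_affine M (cmap c (cstart c)) /\ in_affine M' (cmap c (cend c))
      | None => cmap c (cstart c) = cmap c (cend c)
      end].

Definition avoids_obstacles (R : realType) (L : glink R) : Prop :=
  forall (i : 'I_(ncomp L)) (t : R) (j : 'I_(nobst L)),
    t \in `[cstart (comp i), cend (comp i)] -> 0 <= obst j (cmap (comp i) t).

Definition generalized_link (R : realType) (L : glink R) : Prop :=
  [/\ forall i : 'I_(ncomp L), is_component (comp i),
      forall (i j : 'I_(ncomp L)) (s t : R), i != j ->
        s \in `[cstart (comp i), cend (comp i)] ->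
        t \in `[cstart (comp j), cend (comp j)] ->
        cmap (comp i) s <> cmap (comp j) t,
      forall j : 'I_(nobst L), class_C1 (obst j) /\
        (forall p, obst j p = 0 -> grad (obst j) p <> 0) &
      avoids_obstacles L].

(* A point of L is given by its component and its parameter. *)
Definition lpoint (R : realType) (L : glink R) : Type := ('I_(ncomp L) * R)%type.

Definition on_link (R : realType) (L : glink R) (x : lpoint L) : Prop :=
  x.2 \in `[cstart (comp x.1), cend (comp x.1)].

Definition lpos (R : realType) (L : glink R) (x : lpoint L) : 'rV[R]_3 :=
  cmap (comp x.1) x.2.

Definition apart (R : realType) (L : glink R) (x y : lpoint L) : Prop :=
  [/\ on_link x, on_link y & x.1 != y.1].

Definition GThi (R : realType) (L : glink R) : \bar R :=
  ereal_inf [set d | exists x y : lpoint L,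
    apart x y /\ d = (enorm (lpos x - lpos y))%:E].

Definition gehring_strut (R : realType) (L : glink R) (x y : lpoint L) : Prop :=
  apart x y /\ (enorm (lpos x - lpos y))%:E = GThi L.

Definition wall_strut (R : realType) (L : glink R) (j : 'I_(nobst L))
    (x : lpoint L) : Prop :=
  on_link x /\ obst j (lpos x) = 0.

Definition vectorfield (R : realType) (L : glink R) : Type :=
  'I_(ncomp L) -> R -> 'rV[R]_3.

Definition compatible (R : realType) (L : glink R) (xi : vectorfield L) :
    Prop :=
  forall i : 'I_(ncomp L),
    let c := comp i in
    {within `[cstart c, cend c], continuous (xi i)} /\
    match cends c with
    | Some (M, M') =>
        tangent_to M (xi i (cstart c)) /\ tangent_to M' (xi i (cend c))
    | None => xi i (cstart c) = xi i (cend c)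
    end.

(* The Riemann-Stieltjes integral of f . dT over [a, b]: the limit of tagged
   sums as the mesh of the subdivision a = x_0 < ... < x_n = b, given by
   s = [:: x_1; ...; x_n], tends to 0. *)
Definition RS_sum (R : realType) (f T : R -> 'rV[R]_3) (a : R) (s : seq R)
    (tag : nat -> R) : R :=
  \sum_(k < size s) dot (f (tag k)) (T s`_k - T (a :: s)`_k).

Definition is_RS_integral (R : realType) (f T : R -> 'rV[R]_3) (a b I : R) :
    Prop :=
  forall e : R, 0 < e -> exists2 d : R, 0 < d &
    forall (s : seq R) (tag : nat -> R),
      itv_partition a b s ->
      (forall k, (k < size s)%N -> s`_k - (a :: s)`_k < d) ->
      (forall k, (k < size s)%N -> (a :: s)`_k <= tag k <= s`_k) ->
      `|RS_sum f T a s tag - I| < e.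

Definition RS_integral (R : realType) (f T : R -> 'rV[R]_3) (a b : R) : R :=
  xget 0 [set I | is_RS_integral f T a b I].

(* For a closed component the boundary term vanishes, because the values of
   the tangent at the two ends agree and so do those of a compatible xi. *)
Definition comp_len_var (R : realType) (c : component R)
    (xi : R -> 'rV[R]_3) : R :=
  dot (unit_tangent c (cend c)) (xi (cend c))
  - dot (unit_tangent c (cstart c)) (xi (cstart c))
  - RS_integral xi (unit_tangent c) (cstart c) (cend c).

Definition len_var (R : realType) (L : glink R) (w : 'I_(ncomp L) -> R)
    (xi : vectorfield L) : R :=
  \sum_(i < ncomp L) w i * comp_len_var (comp i) (xi i).

(* Both minima range over compact sets of struts; the infimum over the empty
   set is +oo. *)
Definition GThi_var (R : realType) (L : glink R) (xi : vectorfield L) :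
    \bar R :=
  ereal_inf [set d | exists x y : lpoint L, gehring_strut x y /\
    d = (dot (xi x.1 x.2 - xi y.1 y.2) (direction (lpos x - lpos y)))%:E].

Definition obst_var (R : realType) (L : glink R) (xi : vectorfield L) :
    \bar R :=
  ereal_inf [set d | exists (j : 'I_(nobst L)) (x : lpoint L),
    wall_strut j x /\ d = (dot (xi x.1 x.2) (grad (obst j) (lpos x)))%:E].

Definition strongly_critical (R : realType) (L : glink R)
    (w : 'I_(ncomp L) -> R) : Prop :=
  exists2 e : R, 0 < e &
    forall xi : vectorfield L, compatible xi -> len_var w xi = -1 ->
      (Order.min (GThi_var xi) (obst_var xi) <= (- e)%:E)%E.

(* Below, ti and tj stand for tau_i and tau_j with {i, j} = {1, 2}. *)

Definition claspX0 (R : realType) (ti tj u : R) : R :=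
  let v := tj * (1 - u / ti) in
  Num.sqrt (u ^+ 2 * (1 - v ^+ 2) / (1 - u ^+ 2 * v ^+ 2)).

Definition claspX (R : realType) (ti tj u : R) : R :=
  Num.sg u * claspX0 ti tj `|u|.

(* A Lebesgue integral: for ti = 1 the integrand is unbounded near 1. The value
   of the derivative at ti, where claspX continues beyond the range of the
   parameter, is irrelevant. *)
Definition claspZ (R : realType) (ti tj u : R) : R :=
  (\int[lebesgue_measure]_(s in `[0, `|u|])
     (s / Num.sqrt (1 - s ^+ 2) * derive1 (claspX ti tj) s))%R.

(* The two expressions of h agree:
   h = claspZ t1 t2 t1 + Num.sqrt (1 - t1 ^+ 2). *)
Definition clasph (R : realType) (t1 t2 : R) : R :=
  claspZ t2 t1 t2 + Num.sqrt (1 - t2 ^+ 2).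

Definition arc1 (R : realType) (t1 t2 u : R) : 'rV[R]_3 :=
  vec3 (claspX t1 t2 u) 0 (clasph t1 t2 - claspZ t1 t2 u).

Definition arc2 (R : realType) (t1 t2 u : R) : 'rV[R]_3 :=
  vec3 0 (claspX t2 t1 u) (claspZ t2 t1 u).

(* sg = 1 and sg = -1 give n_+, n_- (resp. m_+, m_-). *)
Definition nvec (R : realType) (t1 sg : R) : 'rV[R]_3 :=
  vec3 (sg * Num.sqrt (1 - t1 ^+ 2)) 0 (- t1).

Definition mvec (R : realType) (t2 sg : R) : 'rV[R]_3 :=
  vec3 0 (sg * Num.sqrt (1 - t2 ^+ 2)) t2.

(* The distance from the end u = t_i of the curved arc to the plane of its
   endpoint, along the unit normal of that plane; by symmetry it is the same
   at the end u = - t_i. *)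
Definition seg1 (R : realType) (t1 t2 c1 : R) : R :=
  c1 - dot (nvec t1 1) (arc1 t1 t2 t1).

Definition seg2 (R : realType) (t1 t2 c2 : R) : R :=
  c2 - dot (mvec t2 1) (arc2 t1 t2 t2).

(* The curve f on [- t, t], continued beyond the two ends by rays in the
   directions dp and dm. *)
Definition extend (R : realType) (t : R) (f : R -> 'rV[R]_3)
    (dp dm : 'rV[R]_3) (u : R) : 'rV[R]_3 :=
  if t < u then f t + (u - t) *: dp
  else if u < - t then f (- t) + (- t - u) *: dm
  else f u.

Definition alpha1 (R : realType) (t1 t2 c1 : R) : component R :=
  let l := t1 + seg1 t1 t2 c1 in
  Component (- l) l (extend t1 (arc1 t1 t2) (nvec t1 1) (nvec t1 (-1)))
    (Some (plane (nvec t1 (-1)) c1, plane (nvec t1 1) c1)).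

Definition alpha2 (R : realType) (t1 t2 c2 : R) : component R :=
  let l := t2 + seg2 t1 t2 c2 in
  Component (- l) l (extend t2 (arc2 t1 t2) (mvec t2 1) (mvec t2 (-1)))
    (Some (plane (mvec t2 (-1)) c2, plane (mvec t2 1) c2)).

Definition clasp_obst (R : realType) (t1 t2 c1 c2 : R) (j : 'I_4)
    (p : 'rV[R]_3) : R :=
  [:: c1 - dot (nvec t1 1) p; c1 - dot (nvec t1 (-1)) p;
      c2 - dot (mvec t2 1) p; c2 - dot (mvec t2 (-1)) p]`_j.

Definition clasp (R : realType) (t1 t2 c1 c2 : R) : glink R :=
  @GLink R 2
    (fun i => if i == ord0 then alpha1 t1 t2 c1 else alpha2 t1 t2 c2)
    4 (clasp_obst t1 t2 c1 c2).

Definition clasp_weight (R : realType) (t1 t2 : R) (i : 'I_2) : R :=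
  if i == ord0 then t1^-1 else t2^-1.

(* Main.v *)
Require Import Defs.
From HB Require Import structures.
From mathcomp Require Import all_boot all_order all_algebra.
From mathcomp Require Import all_classical all_reals all_analysis.
From mathcomp Require Import measurable_realfun.
From mathcomp Require Import ring lra.
Set Implicit Arguments.
Unset Strict Implicit.
Unset Printing Implicit Defensive.
Import Order.TTheory GRing.Theory Num.Theory.
Import numFieldNormedType.Exports.
Local Open Scope classical_set_scope.
Local Open Scope ring_scope.

(** Let u be a parameter on one arc, v = tau_j (1 - u / tau_i) that of its partner
    points on the other arc, and D the difference of height of partner points.

    In its own plane the arc has the unit tangent T u = (sqrt (1 - u^2), u), so that
    - dT = (du / sqrt (1 - u^2)) (u, - sqrt (1 - u^2)). The arcs are designed for
    X_i sqrt (1 - u^2) = u D ([claspX_gap]): the curvature - dT / tau_i of the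
    weighted arc is du / (tau_i D) times the vector (X_i, - D), which is half the sum
    of the two unit struts that join the point to its partners of parameters v
    and - v. As |du| / tau_i = |dv| / tau_j, both arcs see the same measure on the
    struts. For a compatible field the boundary terms vanish, because the end
    tangents are normal to the constraint planes; the variation of the weighted
    length is therefore the integral over s = u / tau_i, from 0 to 1, of 1 / (2 D)
    times the sum of the variations of the four struts at u, - u, v, - v
    ([strut_force_balance]). The mass of this measure is finite, since
    1 / D <= 1 / sqrt (1 - u^2) + 1 / sqrt (1 - v^2) ([gap_inv_le]) and these have
    arcsines as antiderivatives. If all struts had a variation of at least - eps,
    with eps small, the variation of length could not be - 1
    ([clasp_strongly_critical]).

    This uses that partner points are joined by Gehring struts. They are at
    distance 1: X_1^2 + X_2^2 + D^2 = 1 holds by construction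
    ([clasp_unit_distance]), and D is indeed their difference of height because
    Z_1 u + Z_2 v + D has derivative 0 ([clasp_height]). No two points of different
    arcs are closer ([clasp_distance]): when one point is fixed, the distance to the
    other arc decreases until the partner point and increases after it, and the
    straight ends lead away from the other arc.

    The parametrization is singular at isolated points: X' vanishes at 0 if
    tau_j = 1, and Z' is unbounded at the ends if tau_i = 1. For the tangents this
    is harmless because, by Cauchy's mean value theorem, a secant has exactly the
    direction of the tangent at an intermediate parameter
    ([arm_secant_direction]). Z' is integrable because X' is bounded and
    1 / sqrt (1 - u^2) has a bounded antiderivative. The Riemann-Stieltjes integral
    of xi . dT is evaluated by comparing xi(w) . T, on each cell with tag w, with an
    antiderivative of xi . T' ([arm_RS_integral]); that antiderivative exists by the
    substitution u = sin(theta) ([arcsine_antiderivative]). *)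


(** * Clamping, monotonicity and antiderivatives on the line *)
Section Calculus.
Context {R : realType}.
Implicit Types (f g h : R -> R) (a b t u x y : R).

(** Composing with [clamp t] turns a function that is continuous within
    [[- t, t]] into one that is continuous on the whole line, so that no
    one-sided limit has to be handled at the end points. *)
Definition clamp t u : R := Num.max (- t) (Num.min t u).

Ltac split_ifs := repeat match goal with
  |- context [if ?a <= ?b then _ else _] => case: (lerP a b) => ? end.
Ltac clamp_cases := rewrite /clamp; rewrite ?minEle; split_ifs;
  rewrite ?maxEle; split_ifs; try (apply/andP; split); lra.

Lemma clamp_itv t u : 0 <= t -> - t <= clamp t u <= t.
Proof. by move=> ?; clamp_cases. Qed.

Lemma clamp_id t u : - t <= u <= t -> clamp t u = u.
Proof. by move=> ?; clamp_cases. Qed.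

Lemma clamp_hi t u : 0 <= t -> t <= u -> clamp t u = t.
Proof. by move=> ? ?; clamp_cases. Qed.

Lemma clampN t u : 0 <= t -> clamp t (- u) = - clamp t u.
Proof. by move=> ?; clamp_cases. Qed.

Lemma le_clamp t x y : x <= y -> clamp t x <= clamp t y.
Proof. by move=> ?; clamp_cases. Qed.

(** This is what makes sums over a subdivision of a larger interval behave:
    on the image of a cell under [clamp t] no point has been moved. *)
Lemma clamp_between t x y w : 0 <= t -> clamp t x < w < clamp t y -> x < w < y.
Proof.
move=> ?; rewrite /clamp ?minEle; split_ifs; rewrite ?maxEle; split_ifs;
  move=> /andP[? ?]; apply/andP; split; lra.
Qed.

Lemma continuous_clamp t : continuous (clamp t).
Proof.
move=> u; apply: (@continuous_max R R^o (cst (- t)) (fun u => Num.min t u)).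
  exact: cvg_cst.
by apply: (@continuous_min R R^o (cst t) id); [exact: cvg_cst|exact: cvg_id].
Qed.

Lemma continuous_comp_itv (V : topologicalType) (f : R -> V) (g : R -> R) a b :
  {within `[a, b], continuous f} -> continuous g -> (forall u, a <= g u <= b) ->
  continuous (f \o g).
Proof.
move=> /subspace_continuousP cf cg gab u.
have ct : `[a, b]%classic (g u) by rewrite /= in_itv /= gab.
move=> W /(cf _ ct) => /= Wn.
have Wn' := cg _ _ Wn.
apply: (@filterS _ (nbhs u) _ _ _ _ Wn') => x /=; apply.
by rewrite /= in_itv /= gab.
Qed.

Lemma continuous_clamp_comp (V : topologicalType) (f : R -> V) t : 0 <= t ->
  {within `[- t, t], continuous f} -> continuous (f \o clamp t).
Proof.
move=> t0 cf; apply: continuous_comp_itv cf _ _; first exact: continuous_clamp.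
by move=> u; exact: clamp_itv.
Qed.

Lemma within_clamp_comp (V : topologicalType) (f : R -> V) t :
  continuous (f \o clamp t) -> {within `[- t, t], continuous f}.
Proof.
move=> cf; apply: (@subspace_eq_continuous _ _ _ (f \o clamp t)).
  by move=> x; rewrite inE /= in_itv /= => xt; rewrite clamp_id.
exact: continuous_subspaceT.
Qed.

Lemma nondecreasing_of_derive f (df : R -> R) a b : a <= b ->
  (forall x, a < x < b -> is_derive x 1 f (df x) /\ 0 <= df x) ->
  {within `[a, b], continuous f} -> f a <= f b.
Proof.
move=> ab fd fc.
move: ab; rewrite le_eqVlt => /predU1P[->//|ab].
have fd' x : x \in `]a, b[ -> is_derive x 1 f (df x).
  by rewrite in_itv/= => /fd[].
have [c cab e] := MVT ab fd' fc.
rewrite -subr_ge0 e mulr_ge0 ?subr_ge0 ?(ltW ab)//.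
by move: cab; rewrite in_itv/= => /fd[_].
Qed.

(** The mean value inequality with a majorant whose derivative may be
    unbounded at the end points of the interval. *)
Lemma normB_le_of_derive f (df : R -> R) g (dg : R -> R) a b : a <= b ->
  (forall x, a < x < b -> is_derive x 1 f (df x) /\ is_derive x 1 g (dg x)) ->
  (forall x, a < x < b -> `|df x| <= dg x) ->
  continuous f -> continuous g -> `|f b - f a| <= g b - g a.
Proof.
move=> ab fd fg fc gc; rewrite ler_norml; apply/andP; split.
- suff : f a + g a <= f b + g b by lra.
  apply: (@nondecreasing_of_derive (f + g) (df \+ dg)) => //.
    move=> x xab; have [? ?] := fd _ xab; split; first exact: is_deriveD.
    by have := fg _ xab; rewrite ler_norml /= => /andP[]; lra.
  by apply: continuous_subspaceT => x; apply: cvgD; [exact: fc|exact: gc].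
- suff : g a - f a <= g b - f b by lra.
  apply: (@nondecreasing_of_derive (g - f) (dg \- df)) => //.
    move=> x xab; have [? ?] := fd _ xab; split; first exact: is_deriveB.
    by have := fg _ xab; rewrite ler_norml /= => /andP[]; lra.
  by apply: continuous_subspaceT => x; apply: cvgB; [exact: gc|exact: fc].
Qed.

(** [asin] has no useful value outside [[-1, 1]]; clamping makes it
    continuous everywhere. *)
Definition arcsine u : R := asin (clamp 1 u).

Lemma arcsine_itv u : - (pi / 2) <= arcsine u <= pi / 2.
Proof.
by have ? := @clamp_itv 1 u ler01; rewrite /arcsine asin_geNpi2 // asin_lepi2.
Qed.

Lemma sin_arcsine u : -1 <= u <= 1 -> sin (arcsine u) = u.
Proof. by move=> u1; rewrite /arcsine asinK clamp_id // in_itv. Qed.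

Lemma continuous_arcsine : continuous arcsine.
Proof.
apply: continuous_clamp_comp => //.
have := @segment_can_le_continuous R (- (pi / 2)) (pi / 2) sin (@asin R).
rewrite sinN sin_pihalf; apply.
- by have := @pi_gt0 R; lra.
- by apply: continuous_subspaceT; exact: continuous_sin.
- exact: sinK.
Qed.

Lemma is_derive_arcsine u : -1 < u < 1 ->
  is_derive u 1 arcsine (Num.sqrt (1 - u ^+ 2))^-1.
Proof.
move=> u1; have ui : u \in `](-1), 1[ by rewrite in_itv.
apply: (@near_eq_is_derive R R R (@asin R) arcsine).
near=> x; have : x \in `](-1), 1[ by near: x; exact: near_in_itvoo.
by rewrite in_itv /= /arcsine => ?; rewrite clamp_id //; lra.
Unshelve. all: by end_near.
Qed.

Lemma arcsine_gt0 t : 0 < t <= 1 -> 0 < arcsine t.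
Proof.
move=> t01; have := @arcsine_itv t; have := @sin_arcsine t.
have -> : -1 <= t <= 1 by lra.
move=> /(_ isT) st /andP[? ?]; rewrite ltNge; apply/negP => a0.
suff : sin (arcsine t) <= 0 by lra.
rewrite -[arcsine t]opprK sinN oppr_le0 sin_ge0_pi //.
by have pi0 := @pi_gt0 R; apply/andP; split; lra.
Qed.

Lemma antiderivative (phi : R -> R) (M : R) : 0 < M -> continuous phi ->
  exists G : R -> R, forall x, - M < x < M -> is_derive x 1 G (phi x).
Proof.
move=> M0 cphi; exists (fun x => (\int[lebesgue_measure]_(y in `[- M, x]) phi y)%R).
move=> x xM.
have [||||d e] := @continuous_FTC1_closed R phi (- M) x M.
- by case/andP: xM.
- apply: continuous_compact_integrable; first exact: segment_compact.
  exact: continuous_subspaceT.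
- by case/andP: xM.
- exact: cphi.
by apply: DeriveDef; [exact: d|rewrite -derive1E; exact: e].
Qed.

(** The substitution u = sin(theta) turns the integrand into the continuous
    function phi (sin theta), which removes its singularities at -1 and 1. *)
Lemma arcsine_antiderivative (phi : R -> R) : continuous phi ->
  exists2 G : R -> R, continuous G &
    forall u, -1 < u < 1 -> is_derive u 1 G (phi u / Num.sqrt (1 - u ^+ 2)).
Proof.
move=> cphi.
have cps : continuous (phi \o sin).
  by move=> x; apply: continuous_comp; [exact: continuous_sin|exact: cphi].
have [G dG] := @antiderivative (phi \o sin) 2 (ltr0Sn R 1) cps.
have hpi : pi / 2 < 2 :> R by have := @pihalf_ge1 R; have := @pihalf_lt2 R; lra.
have asin2 u : - 2 < arcsine u < 2 by have := arcsine_itv u; lra.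
exists (G \o arcsine).
  move=> u; apply: continuous_comp; first exact: continuous_arcsine.
  by apply/differentiable_continuous/derivable1_diffP; have [] := dG _ (asin2 u).
move=> u u1.
have := @is_derive1_comp R G arcsine u _ _ (dG _ (asin2 u)) (is_derive_arcsine u1).
by rewrite /= sin_arcsine //; lra.
Qed.

(** Compactness of the interval, used as a near covering: a modulus that is
    valid near each point is valid for all points at once. *)
Lemma uniformly_continuous_itv f a b (e : R) : continuous f -> 0 < e ->
  exists2 d : R, 0 < d & forall x y, a <= x <= b -> a <= y <= b -> `|x - y| < d ->
    `|f x - f y| < e.
Proof.
move=> cf e0.
have cK : compact `[a, b] by exact: segment_compact.
move/compact_near_coveringP : cK => /(_ R (0^'+)
   (fun d x => forall y, `|x - y| < d -> `|f x - f y| < e)).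
case.
  move=> x xK.
  have e2 : 0 < e / 2 by lra.
  have := cf x; move=> /cvgrPdist_lt /(_ _ e2) [r /= r0 Hr].
  exists (ball x (r / 2), [set d | 0 < d < r / 2]) => /=.
    split; first by apply: nbhsx_ballx; lra.
    by near=> d => /=; apply/andP; split; near: d;
      [exact: nbhs_right_gt|apply: nbhs_right_lt; lra].
  move=> [x' d] /= [xx' dr] y xy.
  have h1 : `|f x - f x'| < e / 2.
    by apply: Hr; rewrite /ball_ /=; move: xx'; rewrite /ball /=; lra.
  have h2 : `|f x - f y| < e / 2.
    apply: Hr; rewrite /ball_ /=.
    have := ler_distD x' x y; move: xx'; rewrite /ball /=; lra.
  by have := ler_distD (f x) (f x') (f y); rewrite (distrC (f x') (f x)); lra.
move=> r /= r0 Hr; exists (r/2); first by lra.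
move=> x y xab yab xy; apply: (Hr (r/2)) => //=.
- by rewrite sub0r normrN gtr0_norm; lra.
- by lra.
Unshelve. all: by end_near. Qed.

Lemma arcsine0 : arcsine 0 = 0.
Proof.
rewrite /arcsine clamp_id ?oppr_le0 ?ler01 // -[in LHS]sin0 sinK //.
by rewrite in_itv /= oppr_le0 divr_ge0 // pi_ge0.
Qed.

Lemma continuous_sqrt_1Bsqr : continuous (fun u => Num.sqrt (1 - u ^+ 2)).
Proof.
have c : continuous (fun u : R => 1 - u ^+ 2).
  by move=> u; apply: cvgB; [exact: cvg_cst|apply: cvgM; exact: cvg_id].
by move=> u; apply: continuous_comp; [exact: c|exact: sqrt_continuous].
Qed.

Lemma sqr_sqrt_1Bsqr t : 0 < t <= 1 -> Num.sqrt (1 - t ^+ 2) ^+ 2 = 1 - t ^+ 2.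
Proof. by move=> t01; rewrite sqr_sqrtr // subr_ge0 exprn_ile1 //; lra. Qed.

Lemma ge0_itv_sym t u : 0 <= t -> 0 <= u -> u <= t -> - t <= u <= t.
Proof. by move=> t0 u0 ->; rewrite (le_trans _ u0) // oppr_le0. Qed.

Lemma widen_itv_sym t s u : 0 <= s -> - t <= u <= t -> - (t + s) <= u <= t + s.
Proof. by move=> s0 /andP[? ?]; apply/andP; split; lra. Qed.

End Calculus.

(** * The horizontal coordinate of a clasp arc *)
Section ClaspX.
Context {R : realType}.
Implicit Types (s u v x : R).

(** The parameter of the points of the other arc that are joined by struts to
    the points of parameter u. *)
Definition partner (ti tj u : R) : R := tj * (1 - u / ti).

Lemma partnerK (ti tj u : R) : 0 < ti -> 0 < tj ->
  partner tj ti (partner ti tj u) = u.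
Proof. by move=> ti0 tj0; rewrite /partner; field; rewrite !gt_eqF. Qed.

Variables ti tj : R.
Hypotheses (ti01 : 0 < ti <= 1) (tj01 : 0 < tj <= 1).
Local Notation v := (partner ti tj).
Local Notation X := (claspX ti tj).

Let ti0 : 0 < ti. Proof. by case/andP: ti01. Qed.
Let tj0 : 0 < tj. Proof. by case/andP: tj01. Qed.
Let ti1 : ti <= 1. Proof. by case/andP: ti01. Qed.

(* The arithmetic tactics only use the hypotheses that are local to a proof, so
   those of the section are introduced first. *)
Ltac clra := move: ti01 tj01 => ? ?; lra.
Ltac cnra := move: ti01 tj01 => ? ?; nra.

Lemma partner_itv u : 0 <= u <= ti -> 0 <= v u <= tj.
Proof.
move=> /andP[u0 ut]; rewrite /partner pmulr_rge0 ?ger_pMr //.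
have : 0 <= u / ti by rewrite divr_ge0 // ltW.
have : u / ti <= 1 by rewrite ler_pdivrMr // mul1r.
by move=> ? ?; apply/andP; split; clra.
Qed.

Lemma partner_itvoo u : 0 < u < ti -> 0 < v u < tj.
Proof.
move=> /andP[u0 ut]; rewrite /partner pmulr_rgt0 ?gtr_pMr //.
have : 0 < u / ti by rewrite divr_gt0.
have : u / ti < 1 by rewrite ltr_pdivrMr // mul1r.
by move=> ? ?; apply/andP; split; clra.
Qed.

(** With s = u / ti this is s (1 - s) <= 1/4, scaled by ti * tj <= 1. It keeps
    the denominators of the formula for X away from 0. *)
Lemma partner_mul u : u * v u <= 4^-1.
Proof.
rewrite /partner.
have -> : u * (tj * (1 - u / ti)) = (ti * tj) * ((u / ti) * (1 - u / ti)).
  by field; rewrite gt_eqF.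
set s := u / ti.
have h1 : s * (1 - s) <= 4^-1 by have := sqr_ge0 (s - 2^-1); rewrite expr2; clra.
have h2 : 0 < ti * tj <= 1.
  by rewrite mulr_gt0 //=; cnra.
have [h|h] := leP 0 (s * (1 - s)).
  by apply: le_trans h1; apply: ler_piMl => //; clra.
by apply: (@le_trans _ _ 0); [apply: mulr_ge0_le0; clra|clra].
Qed.

Lemma clasp_den_gt0 u : 0 <= u <= ti -> 1 / 2 < 1 - u ^+ 2 * v u ^+ 2.
Proof.
move=> uti; have := partner_mul u; rewrite -exprMn.
have : 0 <= u * v u by rewrite mulr_ge0 //; [case/andP: uti|case/andP: (partner_itv uti)].
set p := u * v u => p0 p4; have : p ^+ 2 <= 4^-1 ^+ 2 by rewrite lerXn2r ?nnegrE //; clra.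
by rewrite [4^-1 ^+ 2]expr2; clra.
Qed.

Lemma claspXE u :
  X u = u * Num.sqrt ((1 - v `|u| ^+ 2) / (1 - `|u| ^+ 2 * v `|u| ^+ 2)).
Proof.
rewrite /claspX /claspX0 -/(v `|u|) -mulrA sqrtrM ?sqr_ge0 // sqrtr_sqr normr_id.
by rewrite mulrA -numEsg.
Qed.

Lemma claspXN u : X (- u) = - X u.
Proof. by rewrite !claspXE normrN mulNr. Qed.

Lemma claspX_sqr u : 0 <= u <= ti ->
  X u ^+ 2 = u ^+ 2 * (1 - v u ^+ 2) / (1 - u ^+ 2 * v u ^+ 2).
Proof.
move=> uti; rewrite claspXE ger0_norm; last by case/andP: uti.
rewrite exprMn sqr_sqrtr; first by rewrite mulrA.
have vb := partner_itv uti.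
apply: divr_ge0; last by have ? := clasp_den_gt0 uti; clra.
by rewrite subr_ge0; apply: exprn_ile1; clra.
Qed.

Lemma claspX_gt0 u : 0 < u <= ti -> 0 < X u.
Proof.
move=> uti; have u0 : 0 < u by case/andP: uti.
have uti' : 0 <= u <= ti by clra.
rewrite claspXE ger0_norm ?ltW // mulr_gt0 // sqrtr_gt0 divr_gt0 //.
  rewrite subr_gt0 expr_lt1 //; last by have ? := partner_itv uti'; clra.
  rewrite /partner; have u' : 0 < u / ti by rewrite divr_gt0.
  by cnra.
by have ? := clasp_den_gt0 uti'; clra.
Qed.

Lemma claspX_end : X ti = ti.
Proof.
rewrite claspXE ger0_norm ?ltW // /partner divff ?gt_eqF // subrr mulr0.
by rewrite expr0n /= mulr0 subr0 divr1 sqrtr1 mulr1.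
Qed.

Lemma continuous_partner : continuous v.
Proof.
move=> u; apply: cvgM; first exact: cvg_cst.
by apply: cvgB; [exact: cvg_cst|apply: cvgM; [exact: cvg_id|exact: cvg_cst]].
Qed.

Lemma continuous_claspX u : `|u| <= ti -> {for u, continuous X}.
Proof.
move=> uti.
have -> : X = (fun u => u * Num.sqrt ((1 - v `|u| ^+ 2) / (1 - `|u| ^+ 2 * v `|u| ^+ 2))).
  by apply/funext => x; exact: claspXE.
have cn : {for u, continuous (fun x => `|x| : R)} by apply: cvg_norm; exact: cvg_id.
have cv : {for u, continuous (fun x => v `|x|)}.
  by apply: continuous_comp; [exact: cn|exact: continuous_partner].
have csq (g : R -> R) : {for u, continuous g} -> {for u, continuous (fun x => g x ^+ 2)}.
  by move=> gc; apply: cvgM; exact: gc.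
have csqrt (g : R -> R) : {for u, continuous g} -> {for u, continuous (fun x => Num.sqrt (g x))}.
  by move=> gc; apply: continuous_comp; [exact: gc|exact: sqrt_continuous].
apply: cvgM; first exact: cvg_id.
apply: csqrt.
apply: cvgM; first by apply: cvgB; [exact: cvg_cst|apply: csq].
apply: cvgV.
  rewrite gt_eqF //; have := @clasp_den_gt0 `|u|.
  by rewrite normr_ge0 uti => /(_ isT) ?; clra.
by apply: cvgB; [exact: cvg_cst|apply: cvgM; apply: csq].
Qed.

Lemma continuous_claspX_clamp : continuous (X \o clamp ti).
Proof.
move=> u; apply: continuous_comp; first exact: continuous_clamp.
by apply: continuous_claspX; rewrite ler_norml clamp_itv // ltW.
Qed.

(** With a = u^2 and b = v^2 the square of X is a (1 - b) / (1 - a b), whose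
    partial derivatives in a and b are (1 - b) / (1 - a b)^2 and
    - a (1 - a) / (1 - a b)^2; here the derivative of v is - tj / ti. *)
Definition dX u : R := (u * (1 - v u ^+ 2) + u ^+ 2 * (1 - u ^+ 2) * v u * (tj / ti))
  / ((1 - u ^+ 2 * v u ^+ 2) ^+ 2 * X u).

Lemma is_derive_partner u : is_derive u 1 v (- (tj / ti)).
Proof.
rewrite /partner; apply: is_derive_eq.
by rewrite /GRing.scale /=; field; rewrite gt_eqF.
Qed.

Lemma is_derive_claspX u : 0 < u < ti -> is_derive u 1 X (dX u).
Proof.
move=> uti; have uti' : 0 <= u <= ti by clra.
pose N u := u ^+ 2 * (1 - v u ^+ 2) / (1 - u ^+ 2 * v u ^+ 2).
have NE x : x \in `]0, ti[ -> Num.sqrt (N x) = X x.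
  rewrite in_itv /= => x0; rewrite /N -claspX_sqr ?sqrtr_sqr ?ger0_norm //; last by clra.
  by rewrite ltW // claspX_gt0 //; clra.
apply: (@near_eq_is_derive R R R (Num.sqrt \o N) X).
  near=> x; apply: NE; near: x; apply: near_in_itvoo; by rewrite in_itv.
have Xu0 : 0 < X u by rewrite claspX_gt0 //; clra.
have Nu0 : 0 < N u by rewrite /N -claspX_sqr ?exprn_gt0.
have d0 : 1 - u ^+ 2 * v u ^+ 2 != 0 by have ? := clasp_den_gt0 uti'; rewrite gt_eqF //; clra.
have dv := is_derive_partner u.
have dN : is_derive u 1 N (2 * (u * (1 - v u ^+ 2) + u ^+ 2 * (1 - u ^+ 2) * v u * (tj / ti))
  / (1 - u ^+ 2 * v u ^+ 2) ^+ 2).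
  have -> : N = (fun u => u ^+ 2 * (1 - v u ^+ 2)) * (fun u => (1 - u ^+ 2 * v u ^+ 2)^-1) by [].
  have dD : is_derive u 1 (fun u => 1 - u ^+ 2 * v u ^+ 2)
      (- (2 * u * v u ^+ 2 - 2 * u ^+ 2 * v u * (tj / ti))).
    by apply: is_derive_eq; rewrite /GRing.scale /=; ring.
  have dI := @is_deriveV R _ u _ 1 d0 dD.
  have dNu : is_derive u 1 (fun u => u ^+ 2 * (1 - v u ^+ 2))
      (2 * u * (1 - v u ^+ 2) + 2 * u ^+ 2 * v u * (tj / ti)).
    by apply: is_derive_eq; rewrite /GRing.scale /=; ring.
  apply: is_derive_eq; rewrite /GRing.scale /=; field.
  by rewrite exprMn d0 gt_eqF.
have := is_derive1_comp (is_derive1_sqrt Nu0) dN.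
set a := (X in is_derive _ _ _ X -> _); suff -> : a = dX u by [].
rewrite /a /dX NE ?in_itv //=; field.
by rewrite exprMn d0 !gt_eqF.
Unshelve. all: by end_near. Qed.

Lemma dX_gt0 u : 0 < u < ti -> 0 < dX u.
Proof.
move=> uti; have uti' : 0 <= u <= ti by clra.
have vb := partner_itvoo uti.
have u1 : u ^+ 2 < 1 by rewrite expr_lt1 //; clra.
have v1 : v u ^+ 2 < 1 by rewrite expr_lt1 //; clra.
have k0 : 0 < tj / ti by exact: divr_gt0.
have d0 := clasp_den_gt0 uti'; have X0 : 0 < X u by apply: claspX_gt0; clra.
apply: divr_gt0.
  apply: addr_gt0; first by apply: mulr_gt0; clra.
  apply: mulr_gt0 => //; apply: mulr_gt0; last clra.
  by apply: mulr_gt0; [apply: exprn_gt0; clra|clra].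
by apply: mulr_gt0 => //; apply: exprn_gt0; clra.
Qed.

(** The bound only serves to dominate the derivative of Z. The delicate case is
    u -> 0 with tj = 1, where 1 - v^2 tends to 0 and the denominator X vanishes
    faster than u: there u * (tj / ti) <= sqrt (1 - v^2) compensates, because
    the square of the left-hand side is at most tj * (u / ti) <= 1 - v <= 1 - v^2. *)
Lemma dX_le u : 0 < u < ti -> dX u <= 16.
Proof.
move=> uti; have uti' : 0 <= u <= ti by clra.
have vb := partner_itvoo uti.
have u1 : u ^+ 2 < 1 by rewrite expr_lt1 //; clra.
have v1 : v u ^+ 2 < 1 by rewrite expr_lt1 //; clra.
have d0 := clasp_den_gt0 uti'.
have X0 : 0 < X u by rewrite claspX_gt0 //; clra.
have d1 : 1 - u ^+ 2 * v u ^+ 2 <= 1 by rewrite lerBlDr lerDl mulr_ge0 // sqr_ge0.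
set w := Num.sqrt (1 - v u ^+ 2).
have w0 : 0 < w by rewrite sqrtr_gt0; clra.
have w2 : w ^+ 2 = 1 - v u ^+ 2 by rewrite sqr_sqrtr //; clra.
have w1 : w <= 1 by have ? := sqr_ge0 (v u); move: w2; rewrite expr2 => ?; cnra.
have Xw : u * w <= X u.
  rewrite claspXE ger0_norm; last by clra.
  rewrite ler_pM2l; last by clra.
  rewrite ler_sqrt; last by rewrite divr_ge0 //; clra.
  by rewrite ler_pdivlMr; [cnra|clra].
have kw : u * (tj / ti) <= w.
  have ku : 0 <= u * (tj / ti) <= 1.
    have a1 : u / ti <= 1 by rewrite ler_pdivrMr // mul1r; clra.
    have a0 : 0 < u / ti by rewrite divr_gt0 //; clra.
    have -> : u * (tj / ti) = tj * (u / ti) by ring.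
    by apply/andP; split; [apply: mulr_ge0|apply: mulr_ile1]; clra.
  have e : v u = tj - u * (tj / ti) by rewrite /partner; ring.
  have t1 : tj <= 1 by clra.
  rewrite leNgt; apply/negP => wk.
  have wk2 : w ^+ 2 < (u * (tj / ti)) ^+ 2 by rewrite ltrXn2r ?nnegrE //; clra.
  move: ku; set k := u * _ in e wk wk2 * => /andP[k0 k1].
  have ? : k ^+ 2 <= k by rewrite expr2; nra.
  have ? : v u ^+ 2 <= v u by rewrite expr2; nra.
  by clra.
have dd0 : 0 < (1 - u ^+ 2 * v u ^+ 2) ^+ 2 * X u.
  by apply: mulr_gt0 => //; apply: exprn_gt0; clra.
rewrite /dX ler_pdivrMr //.
set d := 1 - _ * _ in d0 d1 dd0 *.
have hd : 1/4 <= d ^+ 2 by cnra.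
have h1 : u * (1 - v u ^+ 2) <= u * w by rewrite ler_pM2l -?w2; [cnra|clra].
have h2 : u ^+ 2 * (1 - u ^+ 2) * v u * (tj / ti) <= u * w.
  have -> : u ^+ 2 * (1 - u ^+ 2) * v u * (tj / ti) =
      u * ((1 - u ^+ 2) * v u * (u * (tj / ti))) by ring.
  rewrite ler_pM2l; last by clra.
  have a1 : 0 <= (1 - u ^+ 2) * v u <= 1.
    by have ? := sqr_ge0 u; apply/andP; split; cnra.
  by cnra.
have h3 : 4 * X u <= 16 * (d ^+ 2 * X u) by cnra.
by clra.
Qed.

Lemma continuous_dX u : 0 < u < ti -> {for u, continuous dX}.
Proof.
move=> uti; have uti' : 0 <= u <= ti by clra.
have cv := @continuous_partner u.
have ci : {for u, continuous (fun x : R => x)} by exact: cvg_id.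
have csq (g : R -> R) : {for u, continuous g} -> {for u, continuous (fun x => g x ^+ 2)}.
  by move=> gc; apply: cvgM; exact: gc.
have c1 (g : R -> R) : {for u, continuous g} -> {for u, continuous (fun x => 1 - g x)}.
  by move=> gc; apply: cvgB; [exact: cvg_cst|exact: gc].
have cu1 := c1 _ (csq _ ci); have cv1 := c1 _ (csq _ cv).
apply: cvgM.
  apply: cvgD; first by apply: cvgM; [exact: ci|exact: cv1].
  apply: cvgM; last exact: cvg_cst.
  apply: cvgM; last exact: cv.
  by apply: cvgM; [exact: (csq _ ci)|exact: cu1].
have d0 := clasp_den_gt0 uti'; have X0 : 0 < X u by apply: claspX_gt0; clra.
apply: cvgV.
  by rewrite gt_eqF //; apply: mulr_gt0 => //; apply: exprn_gt0; clra.
apply: cvgM.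
  have cuv : {for u, continuous (fun x => x ^+ 2 * v x ^+ 2)}.
    by apply: cvgM; [exact: (csq _ ci)|exact: (csq _ cv)].
  exact: (csq _ (c1 _ cuv)).
have uabs : `|u| <= ti by rewrite ger0_norm; clra.
exact: (continuous_claspX uabs).
Qed.

End ClaspX.

(** * The vertical coordinate of a clasp arc *)
(** The integrals of f over the intervals exhausting ]a, b[ from the inside are
    bounded by the increments of Q, hence by the oscillation of Q on [a, b], and
    monotone convergence applies. Nothing is required of f and q at a and b,
    where they may be unbounded. *)
Lemma integrable_of_le_derivative (R : realType) (f q Q : R -> R) (a b : R) :
  a < b ->
  {in `]a, b[, continuous f} -> {in `]a, b[, continuous q} ->
  (forall x : R, x \in `]a, b[ -> 0 <= f x <= q x) ->
  (forall x : R, x \in `]a, b[ -> is_derive x 1 Q (q x)) -> continuous Q ->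
  lebesgue_measure.-integrable `[a, b] (EFin \o f).
Proof.
move=> ab cf cq fq dQ cQ.
have mf : measurable_fun `]a, b[ f.
  by apply: open_continuous_measurable_fun; [exact: interval_open|move=> x /set_mem; exact: cf].
have mfc : measurable_fun `[a, b] f by exact: (@measurable_fun_itv_cc _ a b _ _ f mf).
apply/integrableP; split; first exact/measurable_EFinP.
have mabs : measurable_fun `]a, b[ (fun x => `|(f x)%:E|%E).
  by apply: measurableT_comp => //; exact/measurable_EFinP.
rewrite (integral_itv_bndoo true false mabs).
pose e n : R := (b - a) / n.+3%:R.
have e0 n : 0 < e n by rewrite divr_gt0 // subr_gt0.
have e2 n : e n <= (b - a) / 3.
  by rewrite ler_pM2l ?subr_gt0 // lef_pV2 ?posrE // ler_nat.
pose F n := `[a + e n, b - e n]%classic : set R.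
have sub n : F n `<=` `]a, b[.
  by move=> x; rewrite /F /= !in_itv /=; have := e0 n; move=> ? /andP[? ?]; apply/andP; split; lra.
have UF : `]a, b[%classic = \bigcup_n F n.
  apply/seteqP; split => [x|x [n _]]; last exact: sub.
  rewrite /= in_itv /= => /andP[ax xb].
  pose m := Num.min (x - a) (b - x).
  have m0 : 0 < m by rewrite lt_min !subr_gt0 ax.
  exists (Num.truncn ((b - a) / m)) => //.
  set n := Num.truncn _.
  have em : e n <= m.
    rewrite ler_pdivrMr // mulrC -ler_pdivrMr //.
    have := truncnS_gt ((b - a) / m); rewrite -/n => /ltW /le_trans; apply.
    by rewrite ler_nat (leq_trans (leqnSn _) (leqnSn _)).
  have : e n <= x - a by rewrite (le_trans em) // /m ge_min lexx.
  have : e n <= b - x by rewrite (le_trans em) // /m ge_min lexx orbT.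
  by rewrite /F /= in_itv /= => ? ?; apply/andP; split; lra.
have ndF : nondecreasing_seq F.
  move=> m n mn; rewrite subsetEset => x; rewrite /F /= !in_itv /=.
  have : e n <= e m by rewrite ler_pM2l ?subr_gt0 // lef_pV2 ?posrE // ler_nat.
  by move=> ? /andP[? ?]; apply/andP; split; lra.
have cvgF := @ge0_nondecreasing_set_cvg_integral _ (measurableTypeR R) R F (fun x => `|(f x)%:E|%E)
  (@lebesgue_measure R) ndF.
rewrite UF.
have [m [M HM]] : exists m M : R, forall x, x \in `[a, b] -> m <= Q x <= M.
  have cQab : {within `[a, b], continuous Q} by exact: continuous_subspaceT.
  have [c cab cM] := EVT_max (ltW ab) cQab.
  have [d dab dm] := EVT_min (ltW ab) cQab.
  by exists (Q d), (Q c) => x xab; rewrite cM // dm.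
have mFf i : measurable_fun (F i) (fun x => `|(f x)%:E|%E).
  exact: measurable_funS (sub i) mabs.
have {}cvgF := cvgF (fun i => measurable_itv _) mFf (fun i x _ => abse_ge0 _).
apply: (@le_lt_trans _ _ (M - m)%:E); last exact: ltry.
apply: (cvge_to_le cvgF).
apply: nearW => n.
have sn : {subset `[a + e n, b - e n] <= `]a, b[} by move=> x; exact: sub.
have abn : a + e n < b - e n.
  by have := e2 n; move=> ?; lra.
have cqn : {within `[a + e n, b - e n], continuous q}.
  by apply: continuous_in_subspaceT => x /set_mem /sn; exact: cq.
have dQn : derivable_oo_LRcontinuous Q (a + e n) (b - e n).
  split; first by move=> x /(subset_itv_oo_cc) /sn /dQ [].
    by apply: cvg_at_right_filter; exact: cQ.
  by apply: cvg_at_left_filter; exact: cQ.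
have Q'q : {in `](a + e n), (b - e n)[, derive1 Q =1 q}.
  by move=> x /(subset_itv_oo_cc) /sn /dQ Qx; rewrite derive1E; exact: derive_val.
apply: (@le_trans _ _ (\int[lebesgue_measure]_(x in F n) (q x)%:E)%E).
  apply: ge0_le_integral.
  - exact: measurable_itv.
  - by move=> x _; exact: abse_ge0.
  - exact: mFf.
  - apply/measurable_EFinP; apply: measurable_funS (sub n) _ => //.
    by apply: open_continuous_measurable_fun; [exact: interval_open|move=> x /set_mem; exact: cq].
  - by move=> x xF; have /andP[? ?] := fq _ (sub n x xF); rewrite lee_fin ger0_norm.
rewrite /F.
rewrite (continuous_FTC2 abn cqn dQn Q'q) -EFinB lee_fin.
have /HM : b - e n \in `[a, b] by rewrite in_itv /=; have := e0 n; move=> ?; apply/andP; split; lra.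
have /HM : a + e n \in `[a, b] by rewrite in_itv /=; have := e0 n; move=> ?; apply/andP; split; lra.
by move=> /andP[? ?] /andP[? ?]; lra.
Qed.

Section ClaspZ.
Context {R : realType}.
Implicit Types (s u v x : R).
Variables ti tj : R.
Hypotheses (ti01 : 0 < ti <= 1) (tj01 : 0 < tj <= 1).
Local Notation v := (partner ti tj).
Local Notation X := (claspX ti tj).
Local Notation Z := (claspZ ti tj).
Local Notation dX := (dX ti tj).

Ltac clra := move: ti01 tj01 => ? ?; lra.
Let ti0 : 0 < ti. Proof. by case/andP: ti01. Qed.

Definition claspZ_integrand s : R := s / Num.sqrt (1 - s ^+ 2) * derive1 X s.
Local Notation f := claspZ_integrand.

Let fE s : 0 < s < ti -> f s = s / Num.sqrt (1 - s ^+ 2) * dX s.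
Proof.
move=> sti; rewrite /claspZ_integrand derive1E; congr (_ * _); apply: derive_val.
exact: is_derive_claspX.
Qed.

Let sqrt_gt0 s : 0 < s < ti -> 0 < Num.sqrt (1 - s ^+ 2).
Proof. by move=> sti; rewrite sqrtr_gt0 subr_gt0; apply: exprn_ilt1 => //; clra. Qed.

Let continuous_inv_sqrt s : 0 < s < ti ->
  {for s, continuous (fun x => (Num.sqrt (1 - x ^+ 2))^-1)}.
Proof.
move=> sti; apply: cvgV; first by rewrite gt_eqF // sqrt_gt0.
exact: continuous_sqrt_1Bsqr.
Qed.

Let continuous_f s : 0 < s < ti -> {for s, continuous f}.
Proof.
move=> sti.
have sI : s \in `]0, ti[ by rewrite in_itv.
have cf : {for s, continuous (fun x => x / Num.sqrt (1 - x ^+ 2) * dX x)}.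
  apply: cvgM; last exact: continuous_dX.
  by apply: cvgM; [exact: cvg_id|exact: continuous_inv_sqrt].
suff : f x @[x --> s] --> f s by [].
rewrite fE //.
apply: cvg_trans cf; apply: near_eq_cvg; near=> x; rewrite fE //.
suff : x \in `]0, ti[ by rewrite in_itv.
by near: x; exact: near_in_itvoo.
Unshelve. all: by end_near. Qed.

(** For ti = 1 the integrand is unbounded near ti; it is dominated by 16 times
    the derivative of [arcsine]. *)
Lemma integrable_claspZ : lebesgue_measure.-integrable `[0, ti] (EFin \o f).
Proof.
pose q s := 16 * (Num.sqrt (1 - s ^+ 2))^-1 : R.
pose Q s := 16 * arcsine s : R.
have cf : {in `]0, ti[, continuous f} by move=> s; rewrite in_itv; exact: continuous_f.
have cq : {in `]0, ti[, continuous q}.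
  move=> s; rewrite in_itv => sti; apply: cvgM; first exact: cvg_cst.
  exact: continuous_inv_sqrt.
have fq s : s \in `]0, ti[ -> 0 <= f s <= q s.
  rewrite in_itv /= => sti; rewrite fE // /q.
  have s0 := sqrt_gt0 sti; have d0 := dX_gt0 ti01 tj01 sti.
  have d16 := dX_le ti01 tj01 sti.
  have i0 : 0 < (Num.sqrt (1 - s ^+ 2))^-1 by rewrite invr_gt0.
  rewrite mulrAC; set i := _^-1 in i0 *; rewrite ler_pM2r // pmulr_lge0 //.
  have s1 : s <= 1 by clra.
  by apply/andP; split; nra.
have dQ s : s \in `]0, ti[ -> is_derive s 1 Q (q s).
  rewrite in_itv /= => sti.
  have da : is_derive s 1 arcsine (Num.sqrt (1 - s ^+ 2))^-1.
    by apply: is_derive_arcsine; clra.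
  exact: (is_deriveZ 16 da).
have cQ : continuous Q.
  by move=> s; apply: cvgM; [exact: cvg_cst|exact: continuous_arcsine].
exact: (integrable_of_le_derivative ti0 cf cq fq dQ cQ).
Qed.

Lemma claspZN u : Z (- u) = Z u. Proof. by rewrite /claspZ normrN. Qed.

Lemma claspZ0 : Z 0 = 0.
Proof. by rewrite /claspZ normr0 set_itv1 Rintegral_set1. Qed.

Lemma continuous_claspZ_clamp : continuous (Z \o clamp ti).
Proof.
have c := parameterized_integral_continuous (ltW ti0) integrable_claspZ.
apply: (continuous_comp_itv (g := fun u => `|clamp ti u|) c).
  by move=> u; apply: cvg_norm; exact: continuous_clamp.
by move=> u; rewrite normr_ge0 ler_norml clamp_itv // ltW.
Qed.

Lemma is_derive_claspZ u : 0 < u < ti ->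
  is_derive u 1 Z (u / Num.sqrt (1 - u ^+ 2) * dX u).
Proof.
move=> uti; have /andP[u0 ut] := uti.
have [d e] := continuous_FTC1_closed ut integrable_claspZ u0 (continuous_f uti).
pose F x := (\int[lebesgue_measure]_(t in `[0, x]) f t)%R.
apply: (@near_eq_is_derive R R R F Z).
  near=> x; rewrite /claspZ ger0_norm //.
  suff : x \in `]0, ti[ by rewrite in_itv => /andP[/ltW].
  by near: x; apply: near_in_itvoo; rewrite in_itv.
by apply: DeriveDef; [exact: d|rewrite -derive1E -fE //; exact: e].
Unshelve. all: by end_near. Qed.

Lemma claspZ_within : {within `[- ti, ti], continuous Z}.
Proof. exact: within_clamp_comp continuous_claspZ_clamp. Qed.

Lemma claspX_within : {within `[- ti, ti], continuous X}.
Proof. by apply: within_clamp_comp; exact: continuous_claspX_clamp. Qed.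

Let sub_pos a b : 0 <= a -> b <= ti -> `[a, b]%classic `<=` `[- ti, ti]%classic.
Proof.
by move=> a0 bt x; rewrite /= !in_itv /= => /andP[? ?]; apply/andP; split; clra.
Qed.

Lemma claspX_lt a b : 0 <= a -> a < b -> b <= ti -> X a < X b.
Proof.
move=> a0 ab bt.
have d x : x \in `]a, b[ -> is_derive x 1 X (dX x).
  by rewrite in_itv /= => xab; apply: is_derive_claspX => //; lra.
have [c cab e] := MVT ab d (continuous_subspaceW (sub_pos a0 bt) claspX_within).
rewrite -subr_gt0 e mulr_gt0 ?subr_gt0 // dX_gt0 //.
by move: cab; rewrite in_itv /= => ?; lra.
Qed.

Lemma claspZ_le a b : 0 <= a -> a <= b -> b <= ti -> Z a <= Z b.
Proof.
move=> a0 ab bt.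
apply: (nondecreasing_of_derive ab (df := fun x => x / Num.sqrt (1 - x ^+ 2) * dX x)).
  move=> x xab; have xt : 0 < x < ti by lra.
  split; first exact: is_derive_claspZ.
  apply: mulr_ge0; last exact: ltW (dX_gt0 ti01 tj01 xt).
  by apply: divr_ge0; [lra|exact: sqrtr_ge0].
exact: continuous_subspaceW (sub_pos a0 bt) claspZ_within.
Qed.

(** Cauchy's mean value theorem: the derivatives of Z and X at c have the ratio
    c / sqrt (1 - c^2). The quotient is cleared so that the statement keeps its
    meaning where the derivative of X vanishes or that of Z is infinite. *)
Lemma clasp_secant_slope a b : 0 <= a -> a < b -> b <= ti -> exists2 c : R, a < c < b &
  (Z b - Z a) * Num.sqrt (1 - c ^+ 2) = (X b - X a) * c.
Proof.
move=> a0 ab bt.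
have dx x : x \in `]a, b[ -> is_derive x 1 X (dX x).
  by rewrite in_itv /= => xab; apply: is_derive_claspX => //; lra.
have dz x : x \in `]a, b[ -> is_derive x 1 Z (x / Num.sqrt (1 - x ^+ 2) * dX x).
  by rewrite in_itv /= => xab; apply: is_derive_claspZ; lra.
have dx0 x : x \in `]a, b[ -> dX x != 0.
  by rewrite in_itv /= => xab; rewrite gt_eqF // dX_gt0 //; lra.
have [c cab e] := cauchy_MVT ab (continuous_subspaceW (sub_pos a0 bt) claspZ_within)
  (continuous_subspaceW (sub_pos a0 bt) claspX_within) dz dx dx0.
exists c; first by move: cab; rewrite in_itv.
have X0 : X b - X a != 0 by rewrite gt_eqF // subr_gt0 claspX_lt.
have s0 : Num.sqrt (1 - c ^+ 2) != 0.
  by rewrite gt_eqF // sqrt_gt0 //; move: cab; rewrite in_itv /= => ?; lra.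
move: e; rewrite mulfK ?dx0 // => e.
have -> : Z b - Z a = c / Num.sqrt (1 - c ^+ 2) * (X b - X a) by rewrite e divfK.
by field.
Qed.

End ClaspZ.

(** * Struts: height, length and normality *)
(** The difference of height of two partner points, see [clasp_height]. *)
Definition gap (R : realType) (u v : R) : R :=
  Num.sqrt ((1 - u ^+ 2) * (1 - v ^+ 2) / (1 - u ^+ 2 * v ^+ 2)).

Lemma gapC (R : realType) (u v : R) : gap u v = gap v u.
Proof. by rewrite /gap [_ * (1 - v ^+ 2)]mulrC [v ^+ 2 * _]mulrC. Qed.

Section ClaspGap.
Context {R : realType}.
Implicit Types (s u x : R).
Variables ti tj : R.
Hypotheses (ti01 : 0 < ti <= 1) (tj01 : 0 < tj <= 1).
Local Notation v := (partner ti tj).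

Ltac clra := move: ti01 tj01 => ? ?; lra.
Let ti0 : 0 < ti. Proof. by case/andP: ti01. Qed.
Let tj0 : 0 < tj. Proof. by case/andP: tj01. Qed.

Lemma gap_sqr u : 0 <= u <= ti -> gap u (v u) ^+ 2 =
  (1 - u ^+ 2) * (1 - v u ^+ 2) / (1 - u ^+ 2 * v u ^+ 2).
Proof.
move=> uti; have vtj := partner_itv ti01 tj01 uti.
rewrite sqr_sqrtr //; apply: divr_ge0.
  by apply: mulr_ge0; rewrite subr_ge0; apply: exprn_ile1; clra.
by have ? := clasp_den_gt0 ti01 tj01 uti; lra.
Qed.

Lemma gap_gt0 u : 0 < u < ti -> 0 < gap u (v u).
Proof.
move=> uti; have vtj := partner_itvoo ti01 tj01 uti.
rewrite sqrtr_gt0; apply: divr_gt0.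
  by apply: mulr_gt0; rewrite subr_gt0; apply: exprn_ilt1 => //; clra.
have uti' : 0 <= u <= ti by lra.
by have ? := clasp_den_gt0 ti01 tj01 uti'; lra.
Qed.

(** The horizontal and vertical components of a strut at u are in the ratio
    u : sqrt (1 - u^2), that is, the strut projects in the plane of the arc onto
    a normal of the arc. This lets the struts balance the curvature. *)
Lemma claspX_gap u : 0 <= u <= ti ->
  claspX ti tj u * Num.sqrt (1 - u ^+ 2) = u * gap u (v u).
Proof.
move=> uti; rewrite claspXE ger0_norm; last by lra.
rewrite -mulrA -sqrtrM; last first.
  have vtj := partner_itv ti01 tj01 uti; have ? := clasp_den_gt0 ti01 tj01 uti.
  by apply: divr_ge0; [rewrite subr_ge0; apply: exprn_ile1; clra|lra].
by rewrite /gap; congr (u * Num.sqrt _); rewrite mulrAC [_ * (1 - u ^+ 2)]mulrC.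
Qed.

Lemma claspX_partner_sqr u : 0 <= u <= ti -> claspX tj ti (v u) ^+ 2 =
  v u ^+ 2 * (1 - u ^+ 2) / (1 - u ^+ 2 * v u ^+ 2).
Proof.
move=> uti; have vtj := partner_itv ti01 tj01 uti.
by rewrite (claspX_sqr tj01 ti01 vtj) partnerK // [v u ^+ 2 * u ^+ 2]mulrC.
Qed.

Lemma clasp_unit_distance u : 0 <= u <= ti ->
  claspX ti tj u ^+ 2 + claspX tj ti (v u) ^+ 2 + gap u (v u) ^+ 2 = 1.
Proof.
move=> uti; rewrite claspX_sqr // claspX_partner_sqr // gap_sqr //.
have d := clasp_den_gt0 ti01 tj01 uti.
by field; rewrite exprMn gt_eqF //; lra.
Qed.

(** Since 1 / D^2 = 1 / (1 - u^2) + 1 / (1 - v^2) - 1. *)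
Lemma gap_inv_le u : 0 < u < ti ->
  (gap u (v u))^-1 <= (Num.sqrt (1 - u ^+ 2))^-1 + (Num.sqrt (1 - v u ^+ 2))^-1.
Proof.
move=> uti; have vtj := partner_itvoo ti01 tj01 uti.
have g0 := gap_gt0 uti.
have uti' : 0 <= u <= ti by lra.
have d := clasp_den_gt0 ti01 tj01 uti'.
have hu : 0 < 1 - u ^+ 2 by rewrite subr_gt0; apply: exprn_ilt1 => //; clra.
have hv : 0 < 1 - v u ^+ 2 by rewrite subr_gt0; apply: exprn_ilt1 => //; clra.
have su0 : 0 < Num.sqrt (1 - u ^+ 2) by rewrite sqrtr_gt0.
have sv0 : 0 < Num.sqrt (1 - v u ^+ 2) by rewrite sqrtr_gt0.
have su := sqr_sqrtr (ltW hu); have sv := sqr_sqrtr (ltW hv).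
have gs := gap_sqr uti'.
set a := Num.sqrt _ in su su0 *; set b := Num.sqrt _ in sv sv0 *.
set g := gap _ _ in g0 gs *.
have {}gs : g ^+ 2 * (1 - u ^+ 2 * v u ^+ 2) = a ^+ 2 * b ^+ 2.
  by rewrite gs su sv divfK // gt_eqF //; lra.
have -> : a^-1 + b^-1 = (a + b) / (a * b) by field; rewrite !gt_eqF.
have ab0 : 0 < a * b by rewrite mulr_gt0.
rewrite -[_^-1]mul1r ler_pdivrMr // mulrAC ler_pdivlMr // mul1r.
have e : ((a + b) * g) ^+ 2 - (a * b) ^+ 2 = g ^+ 2 * (2 * (a * b) + (a * b) ^+ 2).
  have u2 : u ^+ 2 = 1 - a ^+ 2 by lra.
  have v2 : v u ^+ 2 = 1 - b ^+ 2 by lra.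
  by rewrite [in LHS](exprMn _ a) -gs u2 v2; ring.
have abg : 0 <= (a + b) * g by apply: mulr_ge0; lra.
rewrite -(@ler_pXn2r _ 2) ?nnegrE ?(ltW ab0) // -subr_ge0 e.
by apply: mulr_ge0; [exact: sqr_ge0|apply: addr_ge0; [lra|exact: sqr_ge0]].
Qed.

End ClaspGap.

Section ClaspHeight.
Context {R : realType}.
Variables t1 t2 : R.
Hypotheses (t101 : 0 < t1 <= 1) (t201 : 0 < t2 <= 1).
Local Notation v := (partner t1 t2).

Ltac clra := move: t101 t201 => ? ?; lra.
Let t10 : 0 < t1. Proof. by case/andP: t101. Qed.
Let t20 : 0 < t2. Proof. by case/andP: t201. Qed.

Let X1 := claspX t1 t2 \o clamp t1.
Let X2 := claspX t2 t1 \o clamp t2.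
Let E (u : R) := claspZ t1 t2 (clamp t1 u) + claspZ t2 t1 (clamp t2 (v u))
  + Num.sqrt (1 - X1 u ^+ 2 - X2 (v u) ^+ 2).

Let gapE (u : R) : 0 <= u <= t1 ->
  Num.sqrt (1 - claspX t1 t2 u ^+ 2 - claspX t2 t1 (v u) ^+ 2) = gap u (v u).
Proof.
move=> ut; have e := clasp_unit_distance t101 t201 ut.
have -> : 1 - claspX t1 t2 u ^+ 2 - claspX t2 t1 (v u) ^+ 2 = gap u (v u) ^+ 2.
  by rewrite -e; ring.
by rewrite sqrtr_sqr ger0_norm // sqrtr_ge0.
Qed.

Let EE (u : R) : 0 <= u <= t1 -> E u = claspZ t1 t2 u + claspZ t2 t1 (v u) + gap u (v u).
Proof.
move=> ut; have vt := partner_itv t101 t201 ut.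
have ut' : - t1 <= u <= t1 by clra.
have vt' : - t2 <= v u <= t2 by clra.
rewrite /E /X1 /X2 /= !clamp_id //; congr (_ + _); exact: gapE.
Qed.

Let continuous_E : continuous E.
Proof.
have cv := @continuous_partner R t1 t2.
have c1 := continuous_claspX_clamp t101 t201.
have c2 := continuous_claspX_clamp t201 t101.
have z1 := continuous_claspZ_clamp t101 t201.
have z2 := continuous_claspZ_clamp t201 t101.
have c2v : continuous (X2 \o v) by move=> u; apply: continuous_comp; [exact: cv|exact: c2].
move=> u; apply: cvgD.
  apply: cvgD; first exact: z1.
  by apply: (@continuous_comp _ _ _ v (claspZ t2 t1 \o clamp t2)); [exact: cv|exact: z2].
have c : {for u, continuous (fun u => 1 - X1 u ^+ 2 - X2 (v u) ^+ 2)}.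
  apply: cvgB; last by apply: cvgM; exact: c2v.
  by apply: cvgB; [exact: cvg_cst|apply: cvgM; exact: c1].
by apply: continuous_comp; [exact: c|exact: sqrt_continuous].
Qed.

(** The derivative of the left-hand side is 0. Indeed D = gap u v satisfies
    X1^2 + X2^2 + D^2 = 1, so D' = - (X1 / D) X1' - (X2 / D) X2', where X1 / D
    and X2 / D are the slopes u / sqrt (1 - u^2) and v / sqrt (1 - v^2)
    that define Z1' and Z2'. *)
Lemma clasp_height (u : R) : 0 <= u <= t1 ->
  claspZ t1 t2 u + claspZ t2 t1 (v u) + gap u (v u) = clasph t1 t2.
Proof.
move=> ut.
have E0 : E 0 = clasph t1 t2.
  rewrite EE ?lexx ?ltW // claspZ0 add0r /gap /partner mul0r subr0 mulr1.
  by rewrite expr0n /= mul0r !subr0 mul1r divr1.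
rewrite -EE // -E0.
have u0 : 0 <= u by lra.
suff dE (x : R) : x \in `]0, u[ -> is_derive x 1 E ((fun=> 0) x).
  have [|c _ /eqP] := MVT_segment u0 dE.
    exact/continuous_subspaceT/continuous_E.
  by rewrite mul0r subr_eq0 => /eqP.
rewrite in_itv /= => xu; have xt : 0 < x < t1 by lra.
have vt := partner_itvoo t101 t201 xt.
have xt' : 0 <= x <= t1 by lra.
have g0 := gap_gt0 t101 t201 xt.
have d1 := is_derive_claspX t101 t201 xt.
have d2 := is_derive_claspX t201 t101 vt.
have e1 := is_derive_claspZ t101 t201 xt.
have e2 := is_derive_claspZ t201 t101 vt.
have dv := is_derive_partner t2 t101 x.
have d2v := is_derive1_comp d2 dv.
have e2v := is_derive1_comp e2 dv.
have u1 := clasp_unit_distance t101 t201 xt'.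
have y0 : 0 < 1 - claspX t1 t2 x ^+ 2 - claspX t2 t1 (v x) ^+ 2.
  by have ? : 0 < gap x (v x) ^+ 2 by [rewrite exprn_gt0|]; lra.
have gE : Num.sqrt (1 - claspX t1 t2 x ^+ 2 - claspX t2 t1 (v x) ^+ 2) = gap x (v x).
  exact: gapE.
have n1 := claspX_gap t101 t201 xt'.
have n2 : claspX t2 t1 (v x) * Num.sqrt (1 - v x ^+ 2) = v x * gap x (v x).
  have vt' : 0 <= v x <= t2 by lra.
  by rewrite (claspX_gap t201 t101 vt') partnerK // gapC.
pose Y (u : R) := 1 - claspX t1 t2 u ^+ 2 - claspX t2 t1 (v u) ^+ 2 : R.
have dy : is_derive x 1 Y (- (2 * claspX t1 t2 x * dX t1 t2 x)
    + 2 * claspX t2 t1 (v x) * dX t2 t1 (v x) * (t2 / t1)).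
  have d2v' : is_derive x 1 (fun u => claspX t2 t1 (v u)) (dX t2 t1 (v x) * - (t2 / t1)) by [].
  by apply: is_derive_eq; rewrite /GRing.scale /=; ring.
have Y0 : 0 < Y x := y0.
have YE : Num.sqrt (Y x) = gap x (v x) := gE.
have ds := @is_derive1_comp R Num.sqrt Y x _ _ (is_derive1_sqrt Y0) dy.
have dsum := is_deriveD (is_deriveD e1 e2v) ds.
apply: (@near_eq_is_derive R R R (claspZ t1 t2 + (claspZ t2 t1 \o v) + (Num.sqrt \o Y))).
  near=> y.
  have yt : y \in `]0, t1[ by near: y; apply: near_in_itvoo; rewrite in_itv.
  rewrite in_itv /= in yt.
  have vy := partner_itvoo t101 t201 yt.
  have yt' : - t1 <= y <= t1 by clra.
  have vt' : - t2 <= v y <= t2 by clra.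
  by rewrite /E /X1 /X2 /= !clamp_id.
have s1 : 0 < Num.sqrt (1 - x ^+ 2) by rewrite sqrtr_gt0 subr_gt0; apply: exprn_ilt1 => //; clra.
have s2 : 0 < Num.sqrt (1 - v x ^+ 2) by rewrite sqrtr_gt0 subr_gt0; apply: exprn_ilt1 => //; clra.
have m1 : claspX t1 t2 x = x / Num.sqrt (1 - x ^+ 2) * gap x (v x).
  by rewrite mulrAC -n1 mulfK // gt_eqF.
have m2 : claspX t2 t1 (v x) = v x / Num.sqrt (1 - v x ^+ 2) * gap x (v x).
  by rewrite mulrAC -n2 mulfK // gt_eqF.
set d := (X in is_derive _ _ _ X) in dsum.
suff d0 : d = 0 by rewrite d0 in dsum; exact: dsum.
rewrite /d YE m1 m2; field.
by rewrite !gt_eqF.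
Unshelve. all: by end_near. Qed.

(** The two expressions of the height h of the clasp: evaluate [clasp_height] at
    the end of the first arc, whose partner is the middle of the second. *)
Lemma clasp_height_sym : clasph t2 t1 = clasph t1 t2.
Proof.
have t1t : 0 <= t1 <= t1 by clra.
rewrite [LHS]/clasph -(clasp_height t1t).
have -> : v t1 = 0 by rewrite /partner divff ?gt_eqF // subrr mulr0.
rewrite claspZ0 addr0; congr (_ + _).
by rewrite /gap expr0n /= mulr0 !subr0 mulr1 divr1.
Qed.

End ClaspHeight.

(** * The arcs with their straight ends, and the distance between them *)
Section Arm.
Context {R : realType}.
Variables ti tj : R.
Hypotheses (ti01 : 0 < ti <= 1) (tj01 : 0 < tj <= 1).
Implicit Types u x y : R.
Let ti0 : 0 <= ti. Proof. by case/andP: ti01 => /ltW. Qed.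

(** The coordinates, in the plane of an arc, of the arc prolonged by straight
    rays, with the parameter running at unit speed along the rays. *)
Definition armX u : R :=
  claspX ti tj (clamp ti u) + (u - clamp ti u) * Num.sqrt (1 - ti ^+ 2).
Definition armZ u : R := claspZ ti tj (clamp ti u) + `|u - clamp ti u| * ti.

Lemma armXN u : armX (- u) = - armX u.
Proof. by rewrite /armX clampN // claspXN; ring. Qed.

Lemma armZN u : armZ (- u) = armZ u.
Proof. by rewrite /armZ clampN // claspZN -opprD normrN. Qed.

Lemma armX_norm u : armX u ^+ 2 = armX `|u| ^+ 2.
Proof. by case: (ger0P u) => _ //; rewrite armXN sqrrN. Qed.

Lemma armZ_norm u : armZ u = armZ `|u|.
Proof. by case: (ger0P u) => _ //; rewrite armZN. Qed.

Lemma armX_mid u : - ti <= u <= ti -> armX u = claspX ti tj u.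
Proof. by move=> ut; rewrite /armX clamp_id // subrr mul0r addr0. Qed.

Lemma armZ_mid u : - ti <= u <= ti -> armZ u = claspZ ti tj u.
Proof. by move=> ut; rewrite /armZ clamp_id // subrr normr0 mul0r addr0. Qed.

Lemma armX_hi u : ti <= u -> armX u = ti + (u - ti) * Num.sqrt (1 - ti ^+ 2).
Proof. by move=> ut; rewrite /armX clamp_hi // claspX_end. Qed.

Lemma armZ_hi u : ti <= u -> armZ u = claspZ ti tj ti + (u - ti) * ti.
Proof. by move=> ut; rewrite /armZ clamp_hi // ger0_norm // subr_ge0. Qed.

Lemma continuous_armX : continuous armX.
Proof.
move=> u; apply: cvgD; first exact: continuous_claspX_clamp.
apply: cvgM; last exact: cvg_cst.
by apply: cvgB; [exact: cvg_id|exact: continuous_clamp].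
Qed.

Lemma continuous_armZ : continuous armZ.
Proof.
move=> u; apply: cvgD; first exact: continuous_claspZ_clamp.
apply: cvgM; last exact: cvg_cst.
by apply: cvg_norm; apply: cvgB; [exact: cvg_id|exact: continuous_clamp].
Qed.

End Arm.

(** The straight end starts in the direction (s, t) of its plane, whose inner
    product with the vector from the fixed point of the other arc is t * z' >= 0:
    moving outward increases the distance. *)
Lemma one_segment_distance (R : realType) (x t s r z z' h : R) :
  s ^+ 2 = 1 - t ^+ 2 -> h = z + s -> 0 <= t -> 0 <= r -> 0 <= z' ->
  1 <= x ^+ 2 + t ^+ 2 + (h - z' - z) ^+ 2 ->
  1 <= x ^+ 2 + (t + r * s) ^+ 2 + (h - z' - (z + r * t)) ^+ 2.
Proof.
move=> s2 -> t0 r0 z0 d.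
have -> : x ^+ 2 + (t + r * s) ^+ 2 + (z + s - z' - (z + r * t)) ^+ 2
   = x ^+ 2 + t ^+ 2 + (z + s - z' - z) ^+ 2 + 2 * r * (t * z')
     + r ^+ 2 * (s ^+ 2 + t ^+ 2) by ring.
have p1 : 0 <= r * (t * z') by apply: mulr_ge0 => //; exact: mulr_ge0.
by have p2 := sqr_ge0 r; rewrite s2; lra.
Qed.

(** Besides the terms of [one_segment_distance], one for each end, moving on both
    ends adds a cross term proportional to t * t' >= 0. *)
Lemma two_segments_distance (R : realType) (t s r z t' s' r' z' h : R) :
  s ^+ 2 = 1 - t ^+ 2 -> s' ^+ 2 = 1 - t' ^+ 2 -> h = z + s -> h = z' + s' ->
  0 <= t -> 0 <= t' -> 0 <= r -> 0 <= r' -> 0 <= z -> 0 <= z' ->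
  1 <= t ^+ 2 + t' ^+ 2 + (h - z - z') ^+ 2 ->
  1 <= (t + r * s) ^+ 2 + (t' + r' * s') ^+ 2
       + (h - (z + r * t) - (z' + r' * t')) ^+ 2.
Proof.
move=> s2 s2' h1 h2 t0 t0' r0 r0' z0 z0' d.
have e : (t + r * s) ^+ 2 + (t' + r' * s') ^+ 2
       + (h - (z + r * t) - (z' + r' * t')) ^+ 2
   = t ^+ 2 + t' ^+ 2 + (h - z - z') ^+ 2
     + 2 * (r * t * (s - (h - z - z'))) + 2 * (r' * t' * (s' - (h - z - z')))
     + 2 * (r * r' * (t * t'))
     + r ^+ 2 * (s ^+ 2 + t ^+ 2) + r' ^+ 2 * (s' ^+ 2 + t' ^+ 2) by ring.
have p1 : 0 <= r * t * (s - (h - z - z')) by apply: mulr_ge0; [exact: mulr_ge0|lra].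
have p2 : 0 <= r' * t' * (s' - (h - z - z')) by apply: mulr_ge0; [exact: mulr_ge0|lra].
have p3 : 0 <= r * r' * (t * t') by apply: mulr_ge0; exact: mulr_ge0.
by rewrite e s2 s2'; have p4 := sqr_ge0 r; have p5 := sqr_ge0 r'; lra.
Qed.

Section Distance.
Context {R : realType}.
Variables t1 t2 : R.
Hypotheses (t101 : 0 < t1 <= 1) (t201 : 0 < t2 <= 1).
Implicit Types u x y : R.
Local Notation X1 := (claspX t1 t2).
Local Notation X2 := (claspX t2 t1).
Local Notation Z1 := (claspZ t1 t2).
Local Notation Z2 := (claspZ t2 t1).
Local Notation h := (clasph t1 t2).

Ltac clra := move: t101 t201 => ? ?; lra.
Let t10 : 0 < t1. Proof. by case/andP: t101. Qed.
Let t20 : 0 < t2. Proof. by case/andP: t201. Qed.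

Let is_derive_sqdist u1 u2 : 0 <= u1 <= t1 -> 0 < u2 < t2 ->
  is_derive u2 1 (fun u => X1 u1 ^+ 2 + X2 u ^+ 2 + (h - Z1 u1 - Z2 u) ^+ 2)
   (2 * dX t2 t1 u2 * (u2 / Num.sqrt (1 - u2 ^+ 2)) * (Z1 u1 - Z1 (partner t2 t1 u2))).
Proof.
move=> u1t u2t.
have d2 := is_derive_claspX t201 t101 u2t.
have e2 := is_derive_claspZ t201 t101 u2t.
have s2 : 0 < Num.sqrt (1 - u2 ^+ 2).
  by rewrite sqrtr_gt0 subr_gt0; apply: exprn_ilt1 => //; clra.
have u2t' : 0 <= u2 <= t2 by lra.
have ht := clasp_height t201 t101 u2t'.
rewrite (clasp_height_sym t101 t201) in ht.
have m2 : X2 u2 = u2 / Num.sqrt (1 - u2 ^+ 2) * gap u2 (partner t2 t1 u2).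
  by rewrite mulrAC -(claspX_gap t201 t101 u2t') mulfK // gt_eqF.
apply: is_derive_eq; rewrite /GRing.scale /= m2 -ht.
move: (Z1 u1) (Z2 u2) (Z1 _) (gap _ _) (dX _ _ _) (_ / _) => a b c g d q.
by ring.
Qed.

(** Fix u1 and let w be its partner. As a function of u2, the square of the
    distance has a derivative of the sign of Z1 u1 - Z1 (partner u2): it decreases
    up to u2 = w, where it is 1, and increases afterwards. *)
Lemma clasp_arc_distance u1 u2 : 0 <= u1 <= t1 -> 0 <= u2 <= t2 ->
  1 <= X1 u1 ^+ 2 + X2 u2 ^+ 2 + (h - Z1 u1 - Z2 u2) ^+ 2.
Proof.
move=> u1t u2t.
pose phi u := X1 u1 ^+ 2 + X2 u ^+ 2 + (h - Z1 u1 - Z2 u) ^+ 2.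
pose dphi u := 2 * dX t2 t1 u * (u / Num.sqrt (1 - u ^+ 2)) * (Z1 u1 - Z1 (partner t2 t1 u)).
pose w := partner t1 t2 u1.
have wt : 0 <= w <= t2 := partner_itv t101 t201 u1t.
have phiw : phi w = 1.
  rewrite /phi -(clasp_height t101 t201 u1t) -(clasp_unit_distance t101 t201 u1t) -/w.
  by congr (_ + _ ^+ 2); move: (Z1 _) (Z2 _) (gap _ _) => a b g; ring.
have cphi : {within `[- t2, t2], continuous phi}.
  apply: within_clamp_comp => u.
  have cX := continuous_claspX_clamp t201 t101.
  have cZ := continuous_claspZ_clamp t201 t101.
  apply: cvgD; first by apply: cvgD; [exact: cvg_cst|apply: cvgM; exact: cX].
  have c : {for u, continuous (fun u => h - Z1 u1 - (Z2 \o clamp t2) u)}.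
    by apply: cvgB; [exact: cvg_cst|exact: cZ].
  by apply: cvgM; exact: c.
have sub (a b : R) : 0 <= a -> b <= t2 -> {within `[a, b], continuous phi}.
  move=> a0 bt; apply: continuous_subspaceW cphi => x.
  by rewrite /= !in_itv /= => /andP[? ?]; apply/andP; split; clra.
have pos u : 0 < u < t2 -> 0 <= 2 * dX t2 t1 u * (u / Num.sqrt (1 - u ^+ 2)).
  move=> ut; have d0 := dX_gt0 t201 t101 ut.
  apply: mulr_ge0; first by lra.
  by apply: divr_ge0; [lra|exact: sqrtr_ge0].
have pw : partner t2 t1 w = u1 by rewrite partnerK.
have pa x y : x <= y -> partner t2 t1 y <= partner t2 t1 x.
  by move=> xy; rewrite /partner ler_pM2l // lerD2l lerN2 ler_pM2r // invr_gt0.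
have [uw|wu] := leP u2 w.
- suff : - phi u2 <= - phi w by rewrite phiw lerN2.
  apply: (@nondecreasing_of_derive R (fun u => - phi u) (fun u => - dphi u) _ _ uw).
    move=> x xu; have xt : 0 < x < t2 by lra.
    split; first by apply: is_deriveN; exact: is_derive_sqdist.
    rewrite oppr_ge0 mulr_ge0_le0 ?pos // subr_le0.
    have xt' : 0 <= x <= t2 by lra.
    have px := partner_itv t201 t101 xt'.
    apply: (claspZ_le t101 t201); [lra| |lra].
    by rewrite -pw; apply: pa; lra.
  have c : {within `[u2, w], continuous phi} by apply: sub; lra.
  by move=> x; apply: cvgN; exact: c.
- suff : phi w <= phi u2 by rewrite phiw.
  apply: (@nondecreasing_of_derive R phi dphi _ _ (ltW wu)).
    move=> x xu; have xt : 0 < x < t2 by lra.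
    split; first exact: is_derive_sqdist.
    rewrite mulr_ge0 ?pos // subr_ge0.
    have xt' : 0 <= x <= t2 by lra.
    have px := partner_itv t201 t101 xt'.
    apply: (claspZ_le t101 t201); [lra| |lra].
    by rewrite -pw; apply: pa; lra.
  by apply: sub; lra.
Qed.

Let end_height : h = Z1 t1 + Num.sqrt (1 - t1 ^+ 2).
Proof. by rewrite -(clasp_height_sym t101 t201). Qed.

Let Zge0 ti tj u : 0 < ti <= 1 -> 0 < tj <= 1 -> 0 <= u <= ti -> 0 <= claspZ ti tj u.
Proof.
move=> ti01 tj01 ut; rewrite -(claspZ0 ti tj); apply: claspZ_le => //; lra.
Qed.

Lemma clasp_distance u1 u2 :
  1 <= armX t1 t2 u1 ^+ 2 + armX t2 t1 u2 ^+ 2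
       + (h - armZ t1 t2 u1 - armZ t2 t1 u2) ^+ 2.
Proof.
rewrite (armX_norm t2 t101) (armX_norm t1 t201) (armZ_norm t2 t101) (armZ_norm t1 t201).
have := normr_ge0 u1; have := normr_ge0 u2.
move: `|u1| `|u2| => {u1 u2} x y y0 x0.
have s1 := sqr_sqrt_1Bsqr t101; have s2 := sqr_sqrt_1Bsqr t201.
have t1t : 0 <= t1 <= t1 by clra.
have t2t : 0 <= t2 <= t2 by clra.
have Z10 := Zge0 t101 t201 t1t; have Z20 := Zge0 t201 t101 t2t.
have h1 := end_height; have h2 : h = Z2 t2 + Num.sqrt (1 - t2 ^+ 2) by [].
have X1t := claspX_end t2 t101; have X2t := claspX_end t1 t201.
have t10' := ltW t10; have t20' := ltW t20.
have [xt|/ltW tx] := leP x t1; have [yt|/ltW ty] := leP y t2.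
- have xt' : - t1 <= x <= t1 by exact: ge0_itv_sym.
  have yt' : - t2 <= y <= t2 by exact: ge0_itv_sym.
  rewrite !armX_mid ?armZ_mid //.
  by apply: clasp_arc_distance; rewrite ?x0 ?y0.
- have xt' : - t1 <= x <= t1 by exact: ge0_itv_sym.
  have xt'' : 0 <= x <= t1 by rewrite x0.
  rewrite armX_mid // armX_hi // armZ_mid // armZ_hi //.
  have r0 : 0 <= y - t2 by rewrite subr_ge0.
  have d := clasp_arc_distance xt'' t2t; rewrite X2t in d.
  exact: one_segment_distance s2 h2 t20' r0 (Zge0 t101 t201 xt'') d.
- have yt' : - t2 <= y <= t2 by exact: ge0_itv_sym.
  have yt'' : 0 <= y <= t2 by rewrite y0.
  rewrite armX_hi // armX_mid // armZ_hi // armZ_mid //.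
  have r0 : 0 <= x - t1 by rewrite subr_ge0.
  have d := clasp_arc_distance t1t yt''; rewrite X1t in d.
  rewrite [_ ^+ 2 + X2 y ^+ 2]addrC [h - _ - _]addrAC in d.
  rewrite [_ ^+ 2 + X2 y ^+ 2]addrC [h - _ - _]addrAC.
  exact: one_segment_distance s1 h1 t10' r0 (Zge0 t201 t101 yt'') d.
- rewrite !armX_hi ?armZ_hi //.
  have r0 : 0 <= x - t1 by rewrite subr_ge0.
  have r0' : 0 <= y - t2 by rewrite subr_ge0.
  have d := clasp_arc_distance t1t t2t; rewrite X1t X2t in d.
  exact: two_segments_distance s1 s2 h1 h2 t10' t20' r0 r0' Z10 Z20 d.
Qed.

End Distance.

(** * Directions and tangents of the arcs *)
Section Dot.
Context {R : realType}.
Implicit Types (u v w : 'rV[R]_3) (a : R).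

Lemma dotC u v : dot u v = dot v u.
Proof. by apply: eq_bigr => k _; rewrite mulrC. Qed.

Lemma dotDl u v w : dot (u + v) w = dot u w + dot v w.
Proof. by rewrite /dot -big_split; apply: eq_bigr => k _; rewrite mxE mulrDl. Qed.

Lemma dotZl a u v : dot (a *: u) v = a * dot u v.
Proof. by rewrite /dot mulr_sumr; apply: eq_bigr => k _; rewrite mxE mulrA. Qed.

Lemma dotNl u v : dot (- u) v = - dot u v.
Proof. by rewrite -scaleN1r dotZl mulN1r. Qed.

Lemma dotBl u v w : dot (u - v) w = dot u w - dot v w.
Proof. by rewrite dotDl dotNl. Qed.

Lemma dotDr u v w : dot u (v + w) = dot u v + dot u w.
Proof. by rewrite dotC dotDl !(dotC u). Qed.

Lemma dotZr a u v : dot u (a *: v) = a * dot u v.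
Proof. by rewrite dotC dotZl dotC. Qed.

Lemma dotNr u v : dot u (- v) = - dot u v.
Proof. by rewrite dotC dotNl dotC. Qed.

Lemma dotBr u v w : dot u (v - w) = dot u v - dot u w.
Proof. by rewrite dotDr dotNr. Qed.

Lemma continuous_dotl w : continuous (fun v => dot v w).
Proof.
have c k : continuous (fun v : 'rV[R]_3 => v ord0 k * w ord0 k).
  move=> v; have cv := @coord_continuous R 1 3 ord0 k v.
  exact: (continuousM cv (@cst_continuous _ _ (w ord0 k) v)).
have -> : (fun v => dot v w) = (fun v =>
    v ord0 0 * w ord0 0 + (v ord0 1 * w ord0 1 + v ord0 2 * w ord0 2)).
  apply/funext => v; rewrite /dot !big_ord_recl big_ord0 addr0.
  by congr (_ * _ + (_ * _ + _ * _)); congr (_ _ _); apply: val_inj.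
move=> v; have c0 := @c 0 v; have c1 := @c 1 v; have c2 := @c 2 v.
exact: (continuousD c0 (continuousD c1 c2)).
Qed.

Lemma direction_unit a u : 0 < a -> dot u u = 1 -> direction (a *: u) = u.
Proof.
move=> a0 u1; rewrite /direction /enorm dotZl dotZr u1 mulr1 -expr2 sqrtr_sqr.
by rewrite gtr0_norm // scalerA mulVf ?scale1r // gt_eqF.
Qed.

Lemma dot_vec3 a b c a' b' c' :
  dot (vec3 a b c) (vec3 a' b' c') = a * a' + b * b' + c * c' :> R.
Proof. by rewrite /dot !big_ord_recl big_ord0 !mxE /= addr0 addrA. Qed.

End Dot.

Section ArmCurve.
Context {R : realType}.
Variables (ti tj : R) (o e f : 'rV[R]_3).
Hypotheses (ti01 : 0 < ti <= 1) (tj01 : 0 < tj <= 1).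
Hypotheses (ee : dot e e = 1) (ff : dot f f = 1) (ef : dot e f = 0).
Implicit Types x y u : R.

Let ti0 : 0 < ti. Proof. by case/andP: ti01. Qed.

Definition arm_curve u : 'rV[R]_3 := o + armX ti tj u *: e + armZ ti tj u *: f.

(** At the parameter u of the curved part the tangent is (sqrt (1 - u^2), u) in
    the frame (e, f); it is constant on the rays. *)
Definition arm_tangent u : 'rV[R]_3 :=
  Num.sqrt (1 - clamp ti u ^+ 2) *: e + clamp ti u *: f.

Let clamp_sqr_le1 u : clamp ti u ^+ 2 <= 1.
Proof.
have /andP[ti0' ti1] := ti01.
have c := clamp_itv u (ltW ti0); rewrite -real_normK ?num_real //.
by rewrite exprn_ile1 //; rewrite ler_norml; lra.
Qed.

Lemma arm_tangent_unit u : dot (arm_tangent u) (arm_tangent u) = 1.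
Proof.
rewrite /arm_tangent dotDl !dotDr !dotZl !dotZr ee ff (dotC f) ef.
rewrite !mulr0 !mulr1 addr0 add0r -!expr2 sqr_sqrtr ?subrK //.
by rewrite subr_ge0 clamp_sqr_le1.
Qed.

Lemma continuous_arm_curve : continuous arm_curve.
Proof.
move=> u; apply: cvgD; last by apply: cvgZr_tmp; exact: continuous_armZ.
by apply: cvgD; [exact: cvg_cst|apply: cvgZr_tmp; exact: continuous_armX].
Qed.

Lemma continuous_arm_tangent : continuous arm_tangent.
Proof.
have c : continuous (fun u => Num.sqrt (1 - clamp ti u ^+ 2)).
  have c1 : continuous (fun u => 1 - clamp ti u ^+ 2).
    move=> u; apply: cvgB; first exact: cvg_cst.
    by apply: cvgM; exact: continuous_clamp.
  by move=> u; apply: continuous_comp; [exact: c1|exact: sqrt_continuous].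
move=> u; apply: cvgD; apply: cvgZr_tmp; first exact: c.
exact: continuous_clamp.
Qed.

Let secant x y := exists2 r : R, 0 < r & exists2 c : R, x <= c <= y &
  armX ti tj y - armX ti tj x = r * Num.sqrt (1 - clamp ti c ^+ 2) /\
  armZ ti tj y - armZ ti tj x = r * clamp ti c.

Let secantN x y : secant (- y) (- x) -> secant x y.
Proof.
move=> [r r0 [c cxy]]; rewrite !(armXN tj ti01) !(armZN tj ti01) => -[hx hz].
exists r => //; exists (- c); first by apply/andP; split; lra.
rewrite clampN ?(ltW ti0) // sqrrN mulrN -hx -hz.
by split; ring.
Qed.

Let secant_mid x y : 0 <= x -> x < y -> y <= ti -> secant x y.
Proof.
move=> x0 xy yt; have /andP[_ ti1] := ti01.
have [c cxy e1] := clasp_secant_slope ti01 tj01 x0 xy yt.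
have xt' : - ti <= x <= ti by apply: ge0_itv_sym; lra.
have yt' : - ti <= y <= ti by apply: ge0_itv_sym; lra.
have ct' : - ti <= c <= ti by apply: ge0_itv_sym; lra.
have s0 : 0 < Num.sqrt (1 - c ^+ 2).
  by rewrite sqrtr_gt0 subr_gt0; apply: exprn_ilt1 => //; lra.
exists ((claspX ti tj y - claspX ti tj x) / Num.sqrt (1 - c ^+ 2)).
  by rewrite divr_gt0 // subr_gt0; apply: claspX_lt.
exists c; first by apply/andP; split; lra.
rewrite !armX_mid // !armZ_mid // clamp_id //; split; first by rewrite divfK // gt_eqF.
by rewrite mulrAC -e1 mulfK // gt_eqF.
Qed.

Let secant_hi x y : ti <= x -> x < y -> secant x y.
Proof.
move=> tx xy; exists (y - x); first by rewrite subr_gt0.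
have ty : ti <= y by lra.
exists x; first by apply/andP; split; lra.
rewrite clamp_hi ?(ltW ti0) //.
rewrite !armX_hi // !armZ_hi //.
by split; ring.
Qed.

(** The parameter line cut at - ti, 0 and ti: the derivatives of the coordinates
    are not controlled at these three points. *)
Definition same_piece x y :=
  [\/ y <= - ti, - ti <= x /\ y <= 0, 0 <= x /\ y <= ti | ti <= x].

(** Secants have exactly the direction of the tangent at an intermediate
    parameter. This gives the tangents without differentiating the
    parametrization, which is singular at the points cut out in [same_piece]. *)
Lemma arm_secant_direction x y : x < y -> same_piece x y ->
  exists2 c : R, x <= c <= y &
    direction (arm_curve y - arm_curve x) = arm_tangent c.
Proof.
move=> xy p; suff [r r0 [c cxy [hx hz]]] : secant x y.
  exists c => //; rewrite -[RHS](direction_unit r0 (arm_tangent_unit c)).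
  congr direction; rewrite /arm_curve /arm_tangent scalerDr !scalerA -hx -hz.
  by apply/rowP => k; rewrite !mxE; ring.
have nxy : - y < - x by rewrite ltrN2.
case: p => [yt|[xt y0]|[x0 yt]|tx].
- by apply: secantN; apply: secant_hi => //; lra.
- by apply: secantN; apply: secant_mid => //; lra.
- exact: secant_mid.
- exact: secant_hi.
Qed.

Lemma arm_forward_cvg u :
  direction (arm_curve s - arm_curve u) @[s --> u^'+] --> arm_tangent u.
Proof.
apply/cvgrPdist_lt => eps eps0.
have := @continuous_arm_tangent u; move=> /cvgrPdist_lt /(_ _ eps0) [d /= d0 Hd].
have pc : exists2 y : R, u < y & forall s, u < s < y -> same_piece u s.
  have [h1|h1] := ltP u (- ti).
    by exists (- ti) => // s ?; constructor 1; lra.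
  have [h2|h2] := ltP u 0; first by exists 0 => // s ?; constructor 2; lra.
  have [h3|h3] := ltP u ti; first by exists ti => // s ?; constructor 3; lra.
  by exists (u + 1); [lra|move=> s _; constructor 4].
have [y uy Hy] := pc.
near=> s.
have us : u < s by near: s; exact: nbhs_right_gt.
have sy : s < y by near: s; exact: nbhs_right_lt.
have sd : s < u + d by near: s; apply: nbhs_right_lt; lra.
have [|c cus ->] := arm_secant_direction us; first by apply: Hy; lra.
by apply: Hd; rewrite /ball_ /= distrC ger0_norm; lra.
Unshelve. all: by end_near. Qed.

Lemma arm_backward_cvg u : ti <= u ->
  direction (arm_curve u - arm_curve s) @[s --> u^'-] --> arm_tangent u.
Proof.
move=> tu; apply/cvgrPdist_lt => eps eps0.
have := @continuous_arm_tangent u; move=> /cvgrPdist_lt /(_ _ eps0) [d /= d0 Hd].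
have pc : exists2 y : R, y < u & forall s, y < s < u -> same_piece s u.
  have [h1|h1] := ltP ti u.
    by exists ti => // s ?; constructor 4; lra.
  have tp := ti0; by exists 0; [lra|move=> s ?; constructor 3; lra].
have [y yu Hy] := pc.
near=> s.
have us : s < u by near: s; exact: nbhs_left_lt.
have sy : y < s by near: s; exact: nbhs_left_gt.
have sd : u - d < s by near: s; apply: nbhs_left_gt; lra.
have [|c cus ->] := arm_secant_direction us; first by apply: Hy; lra.
by apply: Hd; rewrite /ball_ /= ger0_norm; lra.
Unshelve. all: by end_near. Qed.

Lemma arm_unit_tangent (c : component R) Ms :
  cmap c = arm_curve -> ti <= cend c -> cends c = Some Ms ->
  unit_tangent c = arm_tangent.
Proof.
move=> cE tc cM; apply/funext => t; rewrite /unit_tangent cM.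
case: ifPn => [_|].
  by rewrite /forward_tangent cE; apply: cvg_lim => //; exact: arm_forward_cvg.
rewrite -leNgt => ct.
rewrite /backward_tangent cE; have -> : arm_tangent t = arm_tangent (cend c).
  by rewrite /arm_tangent !clamp_hi ?(ltW ti0) //; lra.
by apply: cvg_lim => //; exact: arm_backward_cvg.
Qed.

End ArmCurve.

(** * Riemann-Stieltjes integrals along an arc *)
Section RiemannStieltjes.
Context {R : realType}.

Lemma fine_itv_partition (a b d : R) : a < b -> 0 < d ->
  exists2 s, itv_partition a b s &
    forall k, (k < size s)%N -> s`_k - (a :: s)`_k < d.
Proof.
move=> ab d0; pose N := (Num.truncn ((b - a) / d)).+1.
have N0 : 0 < N%:R :> R by rewrite ltr0n.
have step : (b - a) / N%:R < d.
  by rewrite ltr_pdivrMr // mulrC -ltr_pdivrMr // truncnS_gt.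
pose g (i : nat) := a + (b - a) * (i%:R / N%:R).
pose s := mkseq (fun i => g i.+1) N.
have sE k : (k < N)%N -> s`_k = g k.+1 by move=> kN; rewrite nth_mkseq.
have asE k : (k < N)%N -> (a :: s)`_k = g k.
  case: k => [|k] kN; first by rewrite /g mul0r mulr0 addr0.
  by rewrite /= sE // ltnW.
have gS k : g k.+1 - g k = (b - a) / N%:R.
  by rewrite /g -[k.+1%:R]natr1; field; rewrite gt_eqF.
have gN : g N = b by rewrite /g divff ?gt_eqF // mulr1 addrC subrK.
exists s; last by move=> k; rewrite size_mkseq => kN; rewrite sE // asE // gS.
split.
  apply/(pathP 0) => i; rewrite size_mkseq => iN; rewrite asE // sE //.
  by rewrite -subr_gt0 gS divr_gt0 // subr_gt0.
rewrite (last_nth 0) size_mkseq /= sE //.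
by rewrite gN.
Qed.

Lemma is_RS_integral_unique (f T : R -> 'rV[R]_3) (a b I J : R) : a < b ->
  is_RS_integral f T a b I -> is_RS_integral f T a b J -> I = J.
Proof.
move=> ab fI fJ; apply/eqP; rewrite -subr_eq0 -normr_le0 leNgt; apply/negP => IJ.
have e0 : 0 < `|I - J| / 2 by rewrite divr_gt0.
have [d1 d10 H1] := fI _ e0; have [d2 d20 H2] := fJ _ e0.
have d0 : 0 < Num.min d1 d2 by rewrite lt_min d10.
have [s ps ms] := fine_itv_partition ab d0.
have tagP k : (k < size s)%N -> (a :: s)`_k <= s`_k <= s`_k.
  move=> ks; rewrite lexx andbT.
  by case: ps => /(pathP 0) /(_ k ks) /ltW.
have h1 : `|RS_sum f T a s (nth 0 s) - I| < `|I - J| / 2.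
  by apply: H1 => // k /ms; rewrite lt_min => /andP[].
have h2 : `|RS_sum f T a s (nth 0 s) - J| < `|I - J| / 2.
  by apply: H2 => // k /ms; rewrite lt_min => /andP[].
have := ler_distD (RS_sum f T a s (nth 0 s)) I J.
by rewrite (distrC I (RS_sum _ _ _ _ _)); lra.
Qed.

Lemma RS_integralE (f T : R -> 'rV[R]_3) (a b I : R) : a < b ->
  is_RS_integral f T a b I -> RS_integral f T a b = I.
Proof.
move=> ab fI; apply: xget_unique => // J fJ.
exact: is_RS_integral_unique fJ fI.
Qed.

Lemma sum_increments (g : R -> R) (a b : R) (s : seq R) : itv_partition a b s ->
  \sum_(k < size s) (g s`_k - g (a :: s)`_k) = g b - g a.
Proof.
move=> ps; pose u k := g (a :: s)`_k.
have -> : \sum_(k < size s) (g s`_k - g (a :: s)`_k) =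
          \sum_(0 <= k < size s) (u k.+1 - u k) by rewrite big_mkord.
by rewrite telescope_sumr // /u (itv_partition_nth_size 0 ps).
Qed.

End RiemannStieltjes.

Section ArmVariation.
Context {R : realType}.
Variables (t l : R) (e f : 'rV[R]_3).
Hypotheses (t01 : 0 < t <= 1) (tl : t <= l).
Let t0 : 0 < t. Proof. by case/andP: t01. Qed.
Local Notation T := (arm_tangent t e f).

Lemma nondecreasing_scale_bounded_variation (g : R -> R) (a b c : R) :
  {homo g : x y / x <= y} -> bounded_variation a b (fun x => c * g x).
Proof.
move=> gh; have [c0|c0] := leP 0 c.
  by apply: nondecreasing_bounded_variation => x y _ _ xy; rewrite ler_wpM2l // gh.
have -> : (fun x => c * g x) = \- (fun x => - c * g x).
  by apply/funext => x /=; rewrite mulNr opprK.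
apply: bounded_variationN; apply: nondecreasing_bounded_variation => x y _ _ xy.
by rewrite ler_wpM2l ?gh // oppr_ge0 ltW.
Qed.

(** sqrt (1 - clamp^2) increases up to 0 and decreases afterwards; splitting the
    clamped parameter into its negative and positive parts writes it as a sum of
    two monotone functions. *)
Lemma arm_tangent_bounded_variation (a b : R) (k : 'I_3) : a < b ->
  bounded_variation a b (fun u => T u ord0 k).
Proof.
move=> ab.
pose g1 u := Num.sqrt (1 - Num.min (clamp t u) 0 ^+ 2) - 1.
pose g2 u := - Num.sqrt (1 - Num.max (clamp t u) 0 ^+ 2).
have -> : (fun u => T u ord0 k) = (fun u => e ord0 k * g1 u) \+
    ((fun u => - e ord0 k * g2 u) \+ (fun u => f ord0 k * clamp t u)).
  apply/funext => u; rewrite !mxE /= /g1 /g2.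
  case: (leP (clamp t u) 0) => _; rewrite expr0n /= subr0 sqrtr1; ring.
have c x y : x <= y -> clamp t x <= clamp t y := @le_clamp _ t x y.
apply: bounded_variationD => //; last apply: bounded_variationD => //;
  apply: nondecreasing_scale_bounded_variation => //.
- move=> x y /c; rewrite /g1; move: (clamp t x) (clamp t y) => {}x {}y xy.
  rewrite lerD2r; apply: ler_wsqrtr; rewrite lerD2l lerN2.
  rewrite -[X in X <= _]sqrrN -[X in _ <= X]sqrrN.
  apply: lerXn2r; rewrite ?nnegrE ?oppr_ge0 ?ge_min ?lexx ?orbT // lerN2.
  by rewrite le_min !ge_min xy lexx orbT.
- move=> x y /c; rewrite /g2; move: (clamp t x) (clamp t y) => {}x {}y xy.
  rewrite lerN2; apply: ler_wsqrtr; rewrite lerD2l lerN2.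
  apply: lerXn2r; [by rewrite nnegrE le_max lexx orbT|by rewrite nnegrE le_max lexx orbT|].
  by rewrite ge_max !le_max xy lexx orbT.
Qed.

Let l0 : 0 < l. Proof. exact: lt_le_trans t0 tl. Qed.

(** The hypothesis on G says that its derivative is xi . T'. On a cell with tag w,
    the function G - xi(w) . T has the derivative (xi - xi(w)) . T', which is at
    most 2 eta / sqrt (1 - u^2) if the coordinates of xi oscillate by less than
    eta on the cell. So the error on the cell is at most 2 eta times the increment
    of [arcsine], and these increments sum to a bounded quantity, even for t = 1
    where T' is unbounded. *)
Lemma arm_RS_integral (xi : R -> 'rV[R]_3) (G : R -> R) :
  {within `[- l, l], continuous xi} -> continuous G ->
  (forall u : R, - t < u < t -> is_derive u 1 G
     ((Num.sqrt (1 - u ^+ 2) * dot (xi u) f - u * dot (xi u) e) / Num.sqrt (1 - u ^+ 2))) ->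
  RS_integral xi T (- l) l = G t - G (- t).
Proof.
move=> cxi cG dG.
have [tp ll] : 0 < t /\ 0 < l by split; [exact: t0|exact: l0].
apply: RS_integralE; first by lra.
have cdot w : continuous (fun u => dot (xi (clamp l u)) w).
  move=> u; apply: (@continuous_comp _ _ _ (xi \o clamp l) (fun v => dot v w)).
    exact: continuous_clamp_comp (ltW l0) cxi u.
  exact: continuous_dotl.
pose V := arcsine t - arcsine (- t).
have V0 : 0 <= V.
  rewrite subr_ge0; have tt : - t <= t by lra.
  apply: (@nondecreasing_of_derive R arcsine (fun u => (Num.sqrt (1 - u ^+ 2))^-1) _ _ tt).
    move=> u ut; split; last by rewrite invr_ge0 sqrtr_ge0.
    by apply: is_derive_arcsine; have /andP[? ?] := t01; lra.
  exact/continuous_subspaceT/continuous_arcsine.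
move=> eps eps0; pose eta := eps / (2 * V + 1).
have eta0 : 0 < eta by apply: divr_gt0 => //; lra.
have el : clamp t l = t := clamp_hi (ltW t0) tl.
have er : clamp t (- l) = - t by rewrite clampN ?el // ltW.
have [d1 d10 H1] := uniformly_continuous_itv (- l) l (cdot e) eta0.
have [d2 d20 H2] := uniformly_continuous_itv (- l) l (cdot f) eta0.
exists (Num.min d1 d2); first by rewrite lt_min d10.
move=> s tag ps ms tagP.
have gE : G t - G (- t) = \sum_(k < size s) (G (clamp t s`_k) - G (clamp t (- l :: s)`_k)).
  by rewrite (sum_increments (G \o clamp t) ps) /= el er.
have VE : V = \sum_(k < size s) (arcsine (clamp t s`_k) - arcsine (clamp t (- l :: s)`_k)).
  by rewrite (sum_increments (arcsine \o clamp t) ps) /= el er.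
suff term k : (k < size s)%N ->
    `|dot (xi (tag k)) (T s`_k - T (- l :: s)`_k)
      - (G (clamp t s`_k) - G (clamp t (- l :: s)`_k))| <=
    2 * eta * arcsine (clamp t s`_k) - 2 * eta * arcsine (clamp t (- l :: s)`_k).
  rewrite /RS_sum gE -sumrB (le_lt_trans (ler_norm_sum _ _ _)) //.
  apply: (@le_lt_trans _ _ (2 * eta * V)).
    rewrite VE mulr_sumr; apply: ler_sum => k _; rewrite mulrBr; exact: term.
  rewrite /eta mulrAC mulrA ltr_pdivrMr; last by lra.
  by rewrite mulrC ltr_pM2l //; lra.
move=> ks.
have := itv_partition_nth_ge (ltnW ks : (k < (size s).+1)%N) ps.
have := itv_partition_nth_le (ks : (k.+1 < (size s).+1)%N) ps.
rewrite /= (set_nth_default 0 l ks) (set_nth_default 0) //=; last by rewrite ltnW.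
have := ms k ks; have := tagP k ks.
case: (ps) => /(pathP 0) /(_ k ks) + _.
move: (tag k) s`_k (- l :: s)`_k => w y x xy wxy; rewrite lt_min => /andP[m1 m2] yl xl.
have cxy := le_clamp t (ltW xy).
have dotT : dot (xi w) (T y - T x) =
   dot (xi w) e * (Num.sqrt (1 - clamp t y ^+ 2) - Num.sqrt (1 - clamp t x ^+ 2))
   + dot (xi w) f * (clamp t y - clamp t x).
  by rewrite /arm_tangent !dotBr !dotDr !dotZr; ring.
pose F u := G u - dot (xi w) e * Num.sqrt (1 - u ^+ 2) - dot (xi w) f * u.
have -> : dot (xi w) (T y - T x) - (G (clamp t y) - G (clamp t x))
   = - (F (clamp t y) - F (clamp t x)) by rewrite dotT /F; ring.
rewrite normrN.
pose dF (u : R) : R :=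
  (Num.sqrt (1 - u ^+ 2) * dot (xi u) f - u * dot (xi u) e) / Num.sqrt (1 - u ^+ 2)
  - dot (xi w) e * (- u / Num.sqrt (1 - u ^+ 2)) - dot (xi w) f.
have sq (u : R) : - t < u < t -> 0 < 1 - u ^+ 2.
  move=> ut; rewrite subr_gt0 -real_normK ?num_real //; apply: exprn_ilt1 => //.
  by rewrite ltr_norml; have /andP[_ ?] := t01; lra.
have cs := @continuous_sqrt_1Bsqr R.
have mem u : clamp t x < u < clamp t y -> (- t < u < t) /\ (x < u < y).
  move=> uxy; split; last exact: (clamp_between (ltW t0) uxy).
  by have ? := clamp_itv x (ltW t0); have ? := clamp_itv y (ltW t0); lra.
apply: (@normB_le_of_derive R F dF (fun u => 2 * eta * arcsine u)
  (fun u => 2 * eta * (Num.sqrt (1 - u ^+ 2))^-1) _ _ cxy).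
- move=> u /mem[ut _]; have s0 := sq _ ut; have dGu := dG _ ut.
  have u1 : -1 < u < 1 by have /andP[? ?] := t01; lra.
  split; last by have da := is_derive_arcsine u1; exact: (is_deriveZ (2 * eta) da).
  pose Y (u : R) := 1 - u ^+ 2 : R.
  have Y0 : 0 < Y u by [].
  have dY : is_derive u 1 Y (- (2 * u)) by apply: is_derive_eq; rewrite /GRing.scale /=; ring.
  have dS := @is_derive1_comp R Num.sqrt Y u _ _ (is_derive1_sqrt Y0) dY.
  have dS' : is_derive u 1 (fun u : R => Num.sqrt (1 - u ^+ 2)) (- u / Num.sqrt (1 - u ^+ 2)).
    apply: (is_derive_eq dS); rewrite /Y; field; rewrite gt_eqF // sqrtr_gt0 //.
  apply: is_derive_eq; rewrite /dF /GRing.scale /=; ring.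
- move=> u /mem[ut uxy]; have s0 := sq _ ut.
  have q0 : 0 < Num.sqrt (1 - u ^+ 2) by rewrite sqrtr_gt0.
  have q1 : Num.sqrt (1 - u ^+ 2) <= 1.
    by rewrite -[leRHS]sqrtr1 ler_wsqrtr // gerBl sqr_ge0.
  have ul : - l <= u <= l by lra.
  have wl : - l <= w <= l by lra.
  have uw1 : `|u - w| < d1 by rewrite ltr_norml; lra.
  have uw2 : `|u - w| < d2 by rewrite ltr_norml; lra.
  have := ltW (H1 u w ul wl uw1); have := ltW (H2 u w ul wl uw2).
  rewrite !clamp_id // /dF.
  move: (dot (xi u) e) (dot (xi u) f) (dot (xi w) e) (dot (xi w) f) => p q p' q' hq hp.
  have -> : (Num.sqrt (1 - u ^+ 2) * q - u * p) / Num.sqrt (1 - u ^+ 2)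
      - p' * (- u / Num.sqrt (1 - u ^+ 2)) - q'
    = (Num.sqrt (1 - u ^+ 2) * (q - q') - u * (p - p')) / Num.sqrt (1 - u ^+ 2).
    by field; rewrite gt_eqF.
  rewrite normrM normfV (gtr0_norm q0) ler_pM2r ?invr_gt0 //.
  apply: (le_trans (ler_normB _ _)); rewrite !normrM (gtr0_norm q0).
  have u1 : `|u| <= 1 by rewrite ler_norml; have /andP[? ?] := t01; lra.
  have a1 : Num.sqrt (1 - u ^+ 2) * `|q - q'| <= `|q - q'| by rewrite ler_piMl.
  have a2 : `|u| * `|p - p'| <= `|p - p'| by rewrite ler_piMl.
  by lra.
- move=> u; apply: cvgB; last by apply: cvgM; [exact: cvg_cst|exact: cvg_id].
  by apply: cvgB; [exact: cG|apply: cvgM; [exact: cvg_cst|exact: cs]].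
- by move=> u; apply: cvgM; [exact: cvg_cst|exact: continuous_arcsine].
Qed.

End ArmVariation.

(** * The clasp as a generalized link *)
Section Planes.
Context {R : realType}.
Implicit Types (n v p : 'rV[R]_3) (c : R).

Lemma mulmx_tr_dot n v : v *m n^T = (dot v n)%:M.
Proof.
apply/matrixP => i j; rewrite !ord1 !mxE /dot /= mulr1n.
by apply: eq_bigr => k _; rewrite mxE.
Qed.

Lemma tangent_to_plane n c v : tangent_to (plane n c) v <-> dot n v = 0.
Proof.
rewrite /tangent_to /plane /= -[dot n v]dotC; split => [/sub_kermxP|h].
  rewrite mulmx_tr_dot => /matrixP /(_ ord0 ord0).
  by rewrite !mxE /= mulr1n.
by apply/sub_kermxP; rewrite mulmx_tr_dot h; apply/matrixP => i j; rewrite !mxE mul0rn.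
Qed.

Lemma in_plane n c p : dot n n = 1 -> dot n p = c -> in_affine (plane n c) p.
Proof.
move=> n1 np; apply/(tangent_to_plane n c).
by rewrite /= n1 divr1 dotBr dotZr n1 mulr1 np subrr.
Qed.

(** The product with n as a function to which linear structure can be attached,
    so that it is its own differential. *)
Definition dotr n v : R^o := dot v n.

Let dotr_linear n : linear (dotr n).
Proof. by move=> a u v; rewrite /dotr dotDl dotZl. Qed.

HB.instance Definition _ n :=
  GRing.isLinear.Build R 'rV[R]_3 R^o *:%R (dotr n) (dotr_linear n).

Lemma derive_affine n c p v :
  differentiable (fun p => c - dot n p) p /\ 'D_v (fun p => c - dot n p) p = - dot n v.
Proof.
have cn : continuous (dotr n) by exact: continuous_dotl.
have gE : (fun p => c - dot n p) = (cst (c : R^o) - dotr n : 'rV[R]_3 -> R^o).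
  by apply/funext => q; rewrite /dotr dotC.
have dn : differentiable (dotr n) p by exact: linear_differentiable.
rewrite gE; split; first by apply: differentiableB.
rewrite deriveB //; last exact: diff_derivable.
by rewrite derive_cst deriveE // diff_lin // sub0r /dotr dotC.
Qed.

Lemma grad_affine n c p : grad (fun p => c - dot n p) p = - n.
Proof.
apply/rowP => k; rewrite !mxE (derive_affine n c p _).2; congr (- _).
rewrite /dot (bigD1 k) //= mxE !eqxx mulr1 big1 ?addr0 // => i ik.
by rewrite mxE eqxx /= (negPf ik) mulr0.
Qed.

Lemma affine_class_C1 n c : class_C1 (fun p => c - dot n p).
Proof.
split=> [p|]; first by have [] := derive_affine n c p 0.
have -> : grad (fun p => c - dot n p) = fun=> - n by apply/funext => p; exact: grad_affine.
by move=> p; exact: cst_continuous.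
Qed.

Lemma grad_affine_neq0 n c p : dot n n = 1 -> grad (fun p => c - dot n p) p <> 0.
Proof.
rewrite grad_affine => n1 /eqP; rewrite oppr_eq0 => /eqP n0.
by move: n1; rewrite n0 -(scale0r 0) dotZl mul0r => /eqP; rewrite eq_sym oner_eq0.
Qed.

End Planes.

Section Vec3.
Context {R : realType}.

Lemma vec3D (a b c a' b' c' : R) :
  vec3 a b c + vec3 a' b' c' = vec3 (a + a') (b + b') (c + c').
Proof. by apply/rowP => -[[|[|[|//]]] ?]; rewrite !mxE. Qed.

Lemma vec3Z (k a b c : R) : k *: vec3 a b c = vec3 (k * a) (k * b) (k * c).
Proof. by apply/rowP => -[[|[|[|//]]] ?]; rewrite !mxE. Qed.

Lemma vec3N (a b c : R) : - vec3 a b c = vec3 (- a) (- b) (- c).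
Proof. by apply/rowP => -[[|[|[|//]]] ?]; rewrite !mxE. Qed.

End Vec3.

Section ClaspComponents.
Context {R : realType}.
Variables (t1 t2 : R).
Hypotheses (t101 : 0 < t1 <= 1) (t201 : 0 < t2 <= 1).
Local Notation h := (clasph t1 t2).
Let t10 : 0 < t1. Proof. by case/andP: t101. Qed.
Let t20 : 0 < t2. Proof. by case/andP: t201. Qed.

Lemma extend_arm (ti tj k a b : R) (q : R -> 'rV[R]_3) : 0 < ti <= 1 -> 0 < tj <= 1 ->
  forall (o e f dp dm : 'rV[R]_3),
  (forall u, q u = o + claspX ti tj u *: e + claspZ ti tj u *: f) ->
  dp = Num.sqrt (1 - ti ^+ 2) *: e + ti *: f ->
  dm = - Num.sqrt (1 - ti ^+ 2) *: e + ti *: f ->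
  extend ti q dp dm = arm_curve ti tj o e f.
Proof.
move=> ti01 tj01 o e f dp dm qE -> ->; apply/funext => u.
have ti0 : 0 < ti by case/andP: ti01.
rewrite /extend /arm_curve; case: ltP => [tu|ut].
  rewrite (armX_hi _ ti01) ?armZ_hi ?(ltW tu) // qE claspX_end //.
  by apply/rowP => j; rewrite !mxE; ring.
case: ltP => [ut'|ut'].
  rewrite -[u in armX _ _ u]opprK -[u in armZ _ _ u]opprK armXN // armZN //.
  have tu' : ti <= - u by rewrite lerNr ltW.
  rewrite (armX_hi _ ti01) ?armZ_hi // qE claspXN // claspZN claspX_end //.
  by apply/rowP => j; rewrite !mxE; ring.
by rewrite armX_mid ?armZ_mid ?ut' // qE.
Qed.

(** The two arcs are the same planar curve, with the roles of the weights
    exchanged and placed in frames whose second vectors are opposite. *)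
Lemma alpha1_curve (c1 : R) : cmap (alpha1 t1 t2 c1) =
  arm_curve t1 t2 (vec3 0 0 h) (vec3 1 0 0) (vec3 0 0 (-1)).
Proof.
rewrite /=; apply: extend_arm => // [u||]; rewrite ?/arc1 ?/nvec !vec3Z ?vec3D;
  by congr vec3; ring.
Qed.

Lemma alpha2_curve (c2 : R) : cmap (alpha2 t1 t2 c2) =
  arm_curve t2 t1 (vec3 0 0 0) (vec3 0 1 0) (vec3 0 0 1).
Proof.
rewrite /=; apply: extend_arm => // [u||]; rewrite ?/arc2 ?/mvec !vec3Z ?vec3D;
  by congr vec3; ring.
Qed.

Lemma arm_curve1E u : arm_curve t1 t2 (vec3 0 0 h) (vec3 1 0 0) (vec3 0 0 (-1)) u =
  vec3 (armX t1 t2 u) 0 (h - armZ t1 t2 u).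
Proof. by rewrite /arm_curve !vec3Z !vec3D; congr vec3; ring. Qed.

Lemma arm_curve2E u : arm_curve t2 t1 (vec3 0 0 0) (vec3 0 1 0) (vec3 0 0 1) u =
  vec3 0 (armX t2 t1 u) (armZ t2 t1 u).
Proof. by rewrite /arm_curve !vec3Z !vec3D; congr vec3; ring. Qed.

Lemma nvec_unit (s : R) : s ^+ 2 = 1 -> dot (nvec t1 s) (nvec t1 s) = 1.
Proof.
move=> s2; rewrite dot_vec3 mul0r addr0 -!expr2 exprMn s2 sqrrN mul1r sqr_sqrtr ?subrK //.
by rewrite subr_ge0 exprn_ile1 //; [exact: ltW|case/andP: t101].
Qed.

Lemma mvec_unit (s : R) : s ^+ 2 = 1 -> dot (mvec t2 s) (mvec t2 s) = 1.
Proof.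
move=> s2; rewrite dot_vec3 mul0r add0r -!expr2 exprMn s2 mul1r sqr_sqrtr ?subrK //.
by rewrite subr_ge0 exprn_ile1 //; [exact: ltW|case/andP: t201].
Qed.

Lemma alpha1_end_planes (c1 : R) : 0 <= seg1 t1 t2 c1 ->
  let c := alpha1 t1 t2 c1 in
  dot (nvec t1 (-1)) (cmap c (cstart c)) = c1 /\ dot (nvec t1 1) (cmap c (cend c)) = c1.
Proof.
move=> s0 c; have -> : cmap c = _ := alpha1_curve c1.
rewrite /= !arm_curve1E (armXN _ t101) (armZN _ t101) !dot_vec3.
have tl : t1 <= t1 + seg1 t1 t2 c1 by rewrite lerDl.
have q := sqr_sqrt_1Bsqr t101.
suff e : Num.sqrt (1 - t1 ^+ 2) * armX t1 t2 (t1 + seg1 t1 t2 c1)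
   - t1 * (h - armZ t1 t2 (t1 + seg1 t1 t2 c1)) = c1 by split; rewrite -[RHS]e; ring.
rewrite armX_hi // armZ_hi // [t1 + _ - t1]addrC addKr.
have : seg1 t1 t2 c1 = c1 - dot (nvec t1 1) (arc1 t1 t2 t1) by [].
rewrite dot_vec3 claspX_end //; move: (seg1 _ _ _) (claspZ _ _ _) (clasph _ _) => s z w.
move: q; set r := Num.sqrt _ => q sE.
have -> : r * (t1 + s * r) - t1 * (w - (z + s * t1)) =
  r * t1 - t1 * (w - z) + s * (r ^+ 2 + t1 ^+ 2) by ring.
by rewrite q sE; ring.
Qed.

Lemma alpha2_end_planes (c2 : R) : 0 <= seg2 t1 t2 c2 ->
  let c := alpha2 t1 t2 c2 in
  dot (mvec t2 (-1)) (cmap c (cstart c)) = c2 /\ dot (mvec t2 1) (cmap c (cend c)) = c2.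
Proof.
move=> s0 c; have -> : cmap c = _ := alpha2_curve c2.
rewrite /= !arm_curve2E (armXN _ t201) (armZN _ t201) !dot_vec3.
have tl : t2 <= t2 + seg2 t1 t2 c2 by rewrite lerDl.
have q := sqr_sqrt_1Bsqr t201.
suff e : Num.sqrt (1 - t2 ^+ 2) * armX t2 t1 (t2 + seg2 t1 t2 c2)
   + t2 * armZ t2 t1 (t2 + seg2 t1 t2 c2) = c2 by split; rewrite -[RHS]e; ring.
rewrite armX_hi // armZ_hi // [t2 + _ - t2]addrC addKr.
have : seg2 t1 t2 c2 = c2 - dot (mvec t2 1) (arc2 t1 t2 t2) by [].
rewrite dot_vec3 claspX_end //; move: (seg2 _ _ _) (claspZ _ _ _) => s z.
move: q; set r := Num.sqrt _ => q sE.
have -> : r * (t2 + s * r) + t2 * (z + s * t2) =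
  r * t2 + t2 * z + s * (r ^+ 2 + t2 ^+ 2) by ring.
by rewrite q sE; ring.
Qed.

Lemma vec3_frame (a b c : R) : dot (vec3 a b c) (vec3 a b c) = a ^+ 2 + b ^+ 2 + c ^+ 2.
Proof. by rewrite dot_vec3 -!expr2. Qed.

Lemma arm_is_component (ti tj s : R) (o e f : 'rV[R]_3) (c : component R) M M' :
  0 < ti <= 1 -> 0 < tj <= 1 -> 0 <= s ->
  dot e e = 1 -> dot f f = 1 -> dot e f = 0 ->
  cstart c = - (ti + s) -> cend c = ti + s -> cmap c = arm_curve ti tj o e f ->
  cends c = Some (M, M') ->
  in_affine M (cmap c (cstart c)) -> in_affine M' (cmap c (cend c)) ->
  is_component c.
Proof.
move=> ti01 tj01 s0 ee ff ef cs ce cE cM iM iM'.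
have ti0 : 0 < ti by case/andP: ti01.
have tc : ti <= cend c by rewrite ce lerDl.
have TE := arm_unit_tangent ti01 tj01 ee ff ef cE tc cM.
have cc : cstart c < cend c by rewrite cs ce; lra.
split=> //.
- by rewrite cE; apply: continuous_subspaceT; exact: continuous_arm_curve.
- split.
  + by move=> t _; apply/cvg_ex; eexists; rewrite cE; exact: arm_forward_cvg.
  + by apply/cvg_ex; eexists; rewrite cE; exact: arm_backward_cvg.
  + by move=> t _; rewrite TE /enorm arm_tangent_unit // sqrtr1.
  + by move=> k; rewrite TE; exact: arm_tangent_bounded_variation.
- by rewrite cM.
Qed.

Lemma alpha1_is_component (c1 : R) : 0 <= seg1 t1 t2 c1 -> is_component (alpha1 t1 t2 c1).
Proof.
move=> s0; have [h1 h2] := alpha1_end_planes s0.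
apply: (arm_is_component t101 t201 s0 _ _ _ _ _ (alpha1_curve c1));
  rewrite ?vec3_frame ?dot_vec3 //; try ring.
- by apply: in_plane h1; apply: nvec_unit; ring.
- by apply: in_plane h2; apply: nvec_unit; ring.
Qed.

Lemma alpha2_is_component (c2 : R) : 0 <= seg2 t1 t2 c2 -> is_component (alpha2 t1 t2 c2).
Proof.
move=> s0; have [h1 h2] := alpha2_end_planes s0.
apply: (arm_is_component t201 t101 s0 _ _ _ _ _ (alpha2_curve c2));
  rewrite ?vec3_frame ?dot_vec3 //; try ring.
- by apply: in_plane h1; apply: mvec_unit; ring.
- by apply: in_plane h2; apply: mvec_unit; ring.
Qed.

Lemma clasp_obst_plane (c1 c2 : R) (j : 'I_4) : exists n c, dot n n = 1 /\
  clasp_obst t1 t2 c1 c2 j = (fun p => c - dot n p).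
Proof.
case: j => -[|[|[|[|//]]]] ?.
- by exists (nvec t1 1), c1; split; [apply: nvec_unit; ring|].
- by exists (nvec t1 (-1)), c1; split; [apply: nvec_unit; ring|].
- by exists (mvec t2 1), c2; split; [apply: mvec_unit; ring|].
- by exists (mvec t2 (-1)), c2; split; [apply: mvec_unit; ring|].
Qed.

Lemma alpha_difference (c1 c2 u1 u2 : R)
  (d := cmap (alpha1 t1 t2 c1) u1 - cmap (alpha2 t1 t2 c2) u2) :
  d = vec3 (armX t1 t2 u1) (- armX t2 t1 u2) (h - armZ t1 t2 u1 - armZ t2 t1 u2).
Proof.
rewrite /d alpha1_curve alpha2_curve arm_curve1E arm_curve2E vec3N vec3D.
by congr vec3; ring.
Qed.

Lemma enormN (v : 'rV[R]_3) : enorm (- v) = enorm v.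
Proof. by rewrite /enorm dotNl dotNr opprK. Qed.

Lemma enorm_alpha_ge1 (c1 c2 u1 u2 : R) :
  1 <= enorm (cmap (alpha1 t1 t2 c1) u1 - cmap (alpha2 t1 t2 c2) u2).
Proof.
rewrite alpha_difference /enorm vec3_frame sqrrN -[leLHS]sqrtr1 ler_wsqrtr //.
exact: clasp_distance.
Qed.

Lemma apart_distance_ge1 (c1 c2 : R) (x y : lpoint (clasp t1 t2 c1 c2)) : x.1 != y.1 ->
  1 <= enorm (lpos x - lpos y).
Proof.
case: x y => [i u] [j w] /=; rewrite /lpos /=.
have [i0|i0] := eqVneq i ord0; have [j0|j0] := eqVneq j ord0.
- by rewrite i0 j0 eqxx.
- by move=> _; exact: enorm_alpha_ge1.
- by move=> _; rewrite -enormN opprB; exact: enorm_alpha_ge1.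
- move=> /negP[]; apply/eqP/val_inj; move: i0 j0; rewrite -!val_eqE.
  by case: i => -[|[|//]] ?; case: j => -[|[|//]] ?.
Qed.

Lemma clasp_generalized_link (c1 c2 : R) :
  0 <= seg1 t1 t2 c1 -> 0 <= seg2 t1 t2 c2 ->
  avoids_obstacles (clasp t1 t2 c1 c2) -> generalized_link (clasp t1 t2 c1 c2).
Proof.
move=> s1 s2 av; split => //.
- by move=> i /=; case: ifP => _; [exact: alpha1_is_component|exact: alpha2_is_component].
- move=> i j u w ij _ _ e.
  have := @apart_distance_ge1 c1 c2 (i, u) (j, w) ij.
  by rewrite /lpos /= e subrr /enorm -(scale0r 0) dotZl mul0r sqrtr0 ler10.
- move=> j; have [n [c [n1 e]]] := clasp_obst_plane c1 c2 j.
  change (@obst R (clasp t1 t2 c1 c2) j) with (clasp_obst t1 t2 c1 c2 j).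
  rewrite e; split; first exact: affine_class_C1.
  by move=> p _; exact: grad_affine_neq0.
Qed.

(** By [apart_distance_ge1] the Gehring thickness is at least 1, and any pair of
    points at distance 1 shows that it is 1. *)
Lemma gehring_strut_of_unit_distance (c1 c2 : R) (x y : lpoint (clasp t1 t2 c1 c2)) :
  apart x y -> enorm (lpos x - lpos y) = 1 -> gehring_strut x y.
Proof.
move=> xy d1; split=> //; rewrite d1; apply/eqP; rewrite eq_le; apply/andP; split.
  by apply: le_ereal_inf_tmp => _ [x' [y' [[_ _ ij] ->]]]; rewrite lee_fin apart_distance_ge1.
by apply: ereal_inf_lbound; exists x, y; rewrite d1.
Qed.

End ClaspComponents.

(** * Balance of curvature and struts *)
(** The boundary terms vanish under the two orthogonality hypotheses, and G is
    an antiderivative of xi . T' along the curved part. *)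
Lemma arm_len_var (R : realType) (ti tj s : R) (o e f : 'rV[R]_3) (c : component R)
    (M M' : affine_subspace R) (xi : R -> 'rV[R]_3) :
  0 < ti <= 1 -> 0 < tj <= 1 -> 0 <= s ->
  dot e e = 1 -> dot f f = 1 -> dot e f = 0 ->
  cstart c = - (ti + s) -> cend c = ti + s -> cmap c = arm_curve ti tj o e f ->
  cends c = Some (M, M') ->
  {within `[cstart c, cend c], continuous xi} ->
  dot (unit_tangent c (cstart c)) (xi (cstart c)) = 0 ->
  dot (unit_tangent c (cend c)) (xi (cend c)) = 0 ->
  exists G : R -> R, [/\ continuous G,
    (forall u : R, - ti < u < ti -> is_derive u 1 G
      ((Num.sqrt (1 - u ^+ 2) * dot (xi u) f - u * dot (xi u) e)
       / Num.sqrt (1 - u ^+ 2))) &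
    comp_len_var c xi = - (G ti - G (- ti))].
Proof.
move=> ti01 tj01 s0 ee ff ef cs ce cE cM cxi h1 h2.
have ti0 : 0 < ti by case/andP: ti01.
have tc : ti <= cend c by rewrite ce lerDl.
have TE := arm_unit_tangent ti01 tj01 ee ff ef cE tc cM.
set l := ti + s in cs ce.
have l0 : 0 <= l by rewrite addr_ge0 // ltW.
rewrite cs ce in cxi.
have cdot w : continuous (fun u => dot (xi (clamp l u)) w).
  move=> u; apply: (@continuous_comp _ _ _ (xi \o clamp l) (fun v => dot v w)).
    exact: continuous_clamp_comp l0 cxi u.
  exact: continuous_dotl.
have cs1 := @continuous_sqrt_1Bsqr R.
have cphi : continuous (fun u : R =>
    Num.sqrt (1 - u ^+ 2) * dot (xi (clamp l u)) f - u * dot (xi (clamp l u)) e).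
  move=> u; apply: cvgB; apply: cvgM; [exact: cs1|exact: cdot|exact: cvg_id|exact: cdot].
have [G cG dG] := arcsine_antiderivative cphi.
have dG' (u : R) : - ti < u < ti -> is_derive u 1 G
      ((Num.sqrt (1 - u ^+ 2) * dot (xi u) f - u * dot (xi u) e) / Num.sqrt (1 - u ^+ 2)).
  move=> ut; have ul : - l <= u <= l by rewrite /l; lra.
  have u1 : -1 < u < 1 by have /andP[? ?] := ti01; lra.
  by have := dG _ u1; rewrite clamp_id.
exists G; split => //.
rewrite /comp_len_var h1 h2 subrr sub0r TE cs ce; congr (- _).
by apply: arm_RS_integral => //; rewrite lerDl.
Qed.

Lemma dot_vec3_basis (R : realType) (w : 'rV[R]_3) (a b c : R) :
  dot w (vec3 a b c) =
  a * dot w (vec3 1 0 0) + b * dot w (vec3 0 1 0) + c * dot w (vec3 0 0 1).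
Proof.
by rewrite -!dotZr -!dotDr !vec3Z !vec3D; congr dot; congr vec3; ring.
Qed.

(** The function that [clasp_strongly_critical] shows to be nondecreasing, with
    variables for its constituents so that the rules of derivation are applied to
    small terms. *)
Lemma is_derive_balance (R : realType) (A B C D E F : R -> R) (u a b c d e f k1 k2 k3 : R) :
  is_derive u 1 A a -> is_derive u 1 B b -> is_derive u 1 C c -> is_derive u 1 D d ->
  is_derive u 1 E e -> is_derive u 1 F f ->
  is_derive u 1 (fun x => - (A x - B x) * k1 + (C x - D x) * k2 + k3 * (E x * k1 - F x * k2))
    (- (a - b) * k1 + (c - d) * k2 + k3 * (e * k1 - f * k2)).
Proof.
by move=> dA dB dC dD dE dF; apply: is_derive_eq; rewrite /GRing.scale /=; ring.
Qed.

(** Write (px, py, pz), (mx, my, mz) for the values of the field at the points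
    u, - u of the first arc and (qx, qy, qz), (nx, ny, nz) for those at the points
    v, - v of the second, with X, Y, D the absolute values of the components of
    the four struts between them. The sum of the four strut variations is
    2 D times the density of the variation of length: the components of the
    struts normal to the plane of each arc cancel in pairs, and by the equations
    on X and Y the remaining ones are proportional to the curvature. The
    inequality on D trades 1 / D for a function with an explicit
    antiderivative. *)
Lemma strut_force_balance (R : realType) (px mx py my pz mz qx nx qy ny qz nz
    X Y D S T u v eps : R) :
  0 < D -> 0 < S -> 0 < T -> 0 <= eps -> X * S = u * D -> Y * T = v * D ->
  D^-1 <= S^-1 + T^-1 ->
  - eps <= X * (px - qx) - Y * (py - qy) + D * (pz - qz) ->
  - eps <= X * (px - nx) + Y * (py - ny) + D * (pz - nz) ->
  - eps <= - X * (mx - qx) - Y * (my - qy) + D * (mz - qz) ->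
  - eps <= - X * (mx - nx) + Y * (my - ny) + D * (mz - nz) ->
  0 <= - ((S * - pz - u * px) / S + (S * - mz + u * mx) / S)
    - ((T * qz - v * qy) / T + (T * nz + v * ny) / T) + 2 * eps * (S^-1 + T^-1).
Proof.
move=> D0 S0 T0 e0 XS YT Dle h1 h2 h3 h4.
have -> : u = X * S / D by rewrite XS mulfK // gt_eqF.
have -> : v = Y * T / D by rewrite YT mulfK // gt_eqF.
set K := S^-1 + T^-1 in Dle *.
have -> : - ((S * - pz - X * S / D * px) / S + (S * - mz + X * S / D * mx) / S)
    - ((T * qz - Y * T / D * qy) / T + (T * nz + Y * T / D * ny) / T)
   = (X * (px - mx) + Y * (qy - ny) + D * (pz + mz - qz - nz)) * D^-1.
  by field; rewrite !gt_eqF.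
have h : - (2 * eps) <= X * (px - mx) + Y * (qy - ny) + D * (pz + mz - qz - nz) by lra.
have i0 : 0 < D^-1 by rewrite invr_gt0.
have a1 : - (2 * eps) * D^-1 <= (X * (px - mx) + Y * (qy - ny) + D * (pz + mz - qz - nz)) * D^-1.
  by rewrite ler_pM2r.
have a2 : 2 * eps * D^-1 <= 2 * eps * K by rewrite ler_wpM2l //; lra.
by lra.
Qed.

Section Critical.
Context {R : realType}.
Variables (t1 t2 c1 c2 : R).
Hypotheses (t101 : 0 < t1 <= 1) (t201 : 0 < t2 <= 1).
Hypotheses (s10 : 0 <= seg1 t1 t2 c1) (s20 : 0 <= seg2 t1 t2 c2).
Local Notation L := (clasp t1 t2 c1 c2).
Local Notation h := (clasph t1 t2).
Let t10 : 0 < t1. Proof. by case/andP: t101. Qed.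
Let t20 : 0 < t2. Proof. by case/andP: t201. Qed.

Let pt1 (u : R) : lpoint L := (ord0 : 'I_(ncomp L), u).
Let pt2 (u : R) : lpoint L := (ord_max : 'I_2, u).

(** The signs s and s' select one of the four struts between the points of
    parameters u, - u and their partners. *)
Lemma clasp_struts (u s s' : R) : 0 <= u <= t1 -> s ^+ 2 = 1 -> s' ^+ 2 = 1 ->
  gehring_strut (pt1 (s * u)) (pt2 (s' * partner t1 t2 u)) /\
  direction (lpos (pt1 (s * u)) - lpos (pt2 (s' * partner t1 t2 u))) =
    vec3 (s * claspX t1 t2 u) (- (s' * claspX t2 t1 (partner t1 t2 u)))
      (gap u (partner t1 t2 u)).
Proof.
move=> ut s2 s2'; have vt := partner_itv t101 t201 ut.
set w := partner t1 t2 u in vt *.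
have sgn (z : R) : z ^+ 2 = 1 -> z = 1 \/ z = -1.
  by move=> z2; have /eqP := z2; rewrite -[X in _ == X](expr1n R 2) eqf_sqr => /orP[] /eqP; auto.
have arm (ti tj x z : R) : 0 < ti <= 1 -> 0 <= x <= ti -> z ^+ 2 = 1 ->
  [/\ armX ti tj (z * x) = z * claspX ti tj x, armZ ti tj (z * x) = claspZ ti tj x &
    - ti <= z * x <= ti].
  move=> ti01 xt z2; have xt' : - ti <= x <= ti by apply: ge0_itv_sym; lra.
  case: (sgn _ z2) => ->.
    by rewrite !mul1r armX_mid // armZ_mid.
  by rewrite !mulN1r armXN // armZN // armX_mid // armZ_mid //; split => //; lra.
have [x1 z1 i1] := arm t1 t2 u s t101 ut s2.
have [x2 z2 i2] := arm t2 t1 w s' t201 vt s2'.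
have dE : lpos (pt1 (s * u)) - lpos (pt2 (s' * w)) =
  vec3 (s * claspX t1 t2 u) (- (s' * claspX t2 t1 w)) (gap u w).
  rewrite /lpos /= alpha_difference // x1 x2 z1 z2 -(clasp_height t101 t201 ut) -/w.
  by congr vec3; move: (claspZ t1 _ _) (claspZ t2 _ _) (gap _ _) => a b g; ring.
have d1 : dot (lpos (pt1 (s * u)) - lpos (pt2 (s' * w)))
    (lpos (pt1 (s * u)) - lpos (pt2 (s' * w))) = 1.
  rewrite dE vec3_frame sqrrN [(s * _) ^+ 2]exprMn [(s' * _) ^+ 2]exprMn s2 s2' !mul1r.
  exact: clasp_unit_distance.
split; last by rewrite -dE -[in LHS](scale1r (_ - _)) direction_unit.
have ap : apart (pt1 (s * u)) (pt2 (s' * w)).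
  by split=> //; rewrite /on_link /= in_itv /=; exact: widen_itv_sym.
by apply: (gehring_strut_of_unit_distance t101 t201 ap); rewrite /enorm d1 sqrtr1.
Qed.

Lemma alpha1_len_var (xi : R -> 'rV[R]_3) (c := alpha1 t1 t2 c1) :
  {within `[cstart c, cend c], continuous xi} ->
  dot (nvec t1 (-1)) (xi (cstart c)) = 0 -> dot (nvec t1 1) (xi (cend c)) = 0 ->
  exists G : R -> R, [/\ continuous G,
    (forall u : R, - t1 < u < t1 -> is_derive u 1 G
      ((Num.sqrt (1 - u ^+ 2) * dot (xi u) (vec3 0 0 (-1)) - u * dot (xi u) (vec3 1 0 0))
       / Num.sqrt (1 - u ^+ 2))) &
    comp_len_var c xi = - (G t1 - G (- t1))].
Proof.
move=> cxi h1 h2.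
have ee : dot (vec3 1 0 0) (vec3 1 0 0) = 1 :> R by rewrite dot_vec3; ring.
have ff : dot (vec3 0 0 (-1)) (vec3 0 0 (-1)) = 1 :> R by rewrite dot_vec3; ring.
have ef : dot (vec3 1 0 0) (vec3 0 0 (-1)) = 0 :> R by rewrite dot_vec3; ring.
have cE := alpha1_curve t101 t201 c1.
have tc : t1 <= t1 + seg1 t1 t2 c1 by rewrite lerDl.
have TE : unit_tangent c = _ := arm_unit_tangent t101 t201 ee ff ef cE tc erefl.
apply: (arm_len_var t101 t201 s10 ee ff ef _ _ cE erefl cxi) => //.
- rewrite TE /arm_tangent clampN ?clamp_hi ?(ltW t10) //= !vec3Z vec3D.
  have -> : vec3 (Num.sqrt (1 - (- t1) ^+ 2) * 1 + - t1 * 0)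
    (Num.sqrt (1 - (- t1) ^+ 2) * 0 + - t1 * 0)
    (Num.sqrt (1 - (- t1) ^+ 2) * 0 + - t1 * -1) = - nvec t1 (-1).
    by rewrite vec3N sqrrN; congr vec3; ring.
  by rewrite dotNl h1 oppr0.
- rewrite TE /arm_tangent clamp_hi ?(ltW t10) //= !vec3Z vec3D.
  rewrite -[RHS]h2; congr dot; rewrite /nvec; congr vec3; ring.
Qed.

Lemma alpha2_len_var (xi : R -> 'rV[R]_3) (c := alpha2 t1 t2 c2) :
  {within `[cstart c, cend c], continuous xi} ->
  dot (mvec t2 (-1)) (xi (cstart c)) = 0 -> dot (mvec t2 1) (xi (cend c)) = 0 ->
  exists G : R -> R, [/\ continuous G,
    (forall u : R, - t2 < u < t2 -> is_derive u 1 G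
      ((Num.sqrt (1 - u ^+ 2) * dot (xi u) (vec3 0 0 1) - u * dot (xi u) (vec3 0 1 0))
       / Num.sqrt (1 - u ^+ 2))) &
    comp_len_var c xi = - (G t2 - G (- t2))].
Proof.
move=> cxi h1 h2.
have ee : dot (vec3 0 1 0) (vec3 0 1 0) = 1 :> R by rewrite dot_vec3; ring.
have ff : dot (vec3 0 0 1) (vec3 0 0 1) = 1 :> R by rewrite dot_vec3; ring.
have ef : dot (vec3 0 1 0) (vec3 0 0 1) = 0 :> R by rewrite dot_vec3; ring.
have cE := alpha2_curve t101 t201 c2.
have tc : t2 <= t2 + seg2 t1 t2 c2 by rewrite lerDl.
have TE : unit_tangent c = _ := arm_unit_tangent t201 t101 ee ff ef cE tc erefl.
apply: (arm_len_var t201 t101 s20 ee ff ef _ _ cE erefl cxi) => //.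
- rewrite TE /arm_tangent clampN ?clamp_hi ?(ltW t20) //= !vec3Z vec3D.
  have -> : vec3 (Num.sqrt (1 - (- t2) ^+ 2) * 0 + - t2 * 0)
    (Num.sqrt (1 - (- t2) ^+ 2) * 1 + - t2 * 0)
    (Num.sqrt (1 - (- t2) ^+ 2) * 0 + - t2 * 1) = - mvec t2 (-1).
    by rewrite vec3N sqrrN; congr vec3; ring.
  by rewrite dotNl h1 oppr0.
- rewrite TE /arm_tangent clamp_hi ?(ltW t20) //= !vec3Z vec3D.
  rewrite -[RHS]h2; congr dot; rewrite /mvec; congr vec3; ring.
Qed.

Let sq (t u : R) : 0 < t <= 1 -> 0 < u < t -> 0 < Num.sqrt (1 - u ^+ 2).
Proof.
by move=> t01 ut; rewrite sqrtr_gt0 subr_gt0; apply: exprn_ilt1 => //; lra.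
Qed.

Let is_deriveNarg (G : R -> R) (u d : R) :
  is_derive (- u) 1 G d -> is_derive u 1 (fun x => G (- x)) (- d).
Proof.
move=> dG; have dN : is_derive u 1 (fun x : R => - x) (-1) by apply: is_derive_eq.
by have := is_derive1_comp dG dN; rewrite mulrN1.
Qed.

(** H u collects the variation of length of the part of the first arc between
    - u and u and, reckoned from the ends, of the part of the second arc joined to
    it by struts, up to a constant; its total increment is the weighted variation
    of length, - 1. K u is eps times an upper bound of the mass of these struts.
    If all strut variations were at least - eps, then H + K would be nondecreasing
    by [strut_force_balance], so that -1 + 2 eps M >= 0; but 2 eps M = 1/2. *)
Lemma clasp_strongly_critical : @strongly_critical R L (clasp_weight t1 t2).
Proof.
pose M := arcsine t1 / t1 + arcsine t2 / t2.
have M0 : 0 < M.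
  by apply: addr_gt0; apply: divr_gt0 => //; exact: arcsine_gt0.
pose eps := (4 * M)^-1.
have eps0 : 0 < eps by rewrite invr_gt0 mulr_gt0.
exists eps => // xi cxi lv.
rewrite leNgt; apply/negP; rewrite lt_min => /andP[gv _].
have [cx1 [tan1 tan1']] := cxi (ord0 : 'I_(ncomp L)).
have [cx2 [tan2 tan2']] := cxi (ord_max : 'I_(ncomp L)).
rewrite /= in cx1 tan1 tan1' cx2 tan2 tan2'.
move: tan1 tan1' tan2 tan2' => /tangent_to_plane tan1 /tangent_to_plane tan1'
  /tangent_to_plane tan2 /tangent_to_plane tan2'.
have [G1 [cG1 dG1 lv1]] := alpha1_len_var cx1 tan1 tan1'.
have [G2 [cG2 dG2 lv2]] := alpha2_len_var cx2 tan2 tan2'.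
have {}lv : - (G1 t1 - G1 (- t1)) / t1 - (G2 t2 - G2 (- t2)) / t2 = -1.
  rewrite -[RHS]lv /len_var /= !big_ord_recl big_ord0 addr0 /=.
  have -> : lift ord0 ord0 = ord_max :> 'I_2 by apply: val_inj.
  rewrite lv1 lv2 /clasp_weight /=; ring.
have strut (u s s' : R) : 0 <= u <= t1 -> s ^+ 2 = 1 -> s' ^+ 2 = 1 ->
  - eps <= s * claspX t1 t2 u * (dot (xi ord0 (s * u)) (vec3 1 0 0)
        - dot (xi ord_max (s' * partner t1 t2 u)) (vec3 1 0 0))
    + - (s' * claspX t2 t1 (partner t1 t2 u)) * (dot (xi ord0 (s * u)) (vec3 0 1 0)
        - dot (xi ord_max (s' * partner t1 t2 u)) (vec3 0 1 0))
    + gap u (partner t1 t2 u) * (dot (xi ord0 (s * u)) (vec3 0 0 1)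
        - dot (xi ord_max (s' * partner t1 t2 u)) (vec3 0 0 1)).
  move=> ut s2 s2'; have [gs dE] := clasp_struts ut s2 s2'.
  rewrite -!dotBl -dot_vec3_basis.
  rewrite -lee_fin ltW // (lt_le_trans gv) //.
  apply: ereal_inf_lbound; exists (pt1 (s * u)), (pt2 (s' * partner t1 t2 u)).
  by split => //; rewrite dE.
have {gv cxi} := strut.
move: lv1 lv2 cx1 cx2 tan1 tan1' tan2 tan2' => _ _ _ _ _ _ _ _ {}strut.
move: (xi ord0) (xi ord_max) strut dG1 dG2 => x1 x2 strut dG1 dG2.
pose v := partner t1 t2.
pose H u := - (G1 u - G1 (- u)) / t1 + (G2 (v u) - G2 (- v u)) / t2.
pose K u := 2 * eps * (arcsine u / t1 - arcsine (v u) / t2).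
pose g1 u :=
  (Num.sqrt (1 - u ^+ 2) * dot (x1 u) (vec3 0 0 (-1)) - u * dot (x1 u) (vec3 1 0 0))
       / Num.sqrt (1 - u ^+ 2).
pose g2 u :=
  (Num.sqrt (1 - u ^+ 2) * dot (x2 u) (vec3 0 0 1) - u * dot (x2 u) (vec3 0 1 0))
       / Num.sqrt (1 - u ^+ 2).
pose dH u := - (g1 u + g1 (- u)) / t1 - (g2 (v u) + g2 (- v u)) / t1.
pose dK u := 2 * eps * ((Num.sqrt (1 - u ^+ 2))^-1 + (Num.sqrt (1 - v u ^+ 2))^-1) / t1.
suff : H 0 + K 0 <= H t1 + K t1.
  have v0 : v 0 = t2 by rewrite /v /partner mul0r subr0 mulr1.
  have vt : v t1 = 0 by rewrite /v /partner divff ?gt_eqF // subrr mulr0.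
  rewrite /H /K v0 vt arcsine0 !oppr0 !mul0r !subrr !(mul0r, oppr0, addr0, add0r, sub0r).
  have e : 2 * eps * M = 2^-1 by rewrite /eps; field; rewrite gt_eqF.
  have -> : - (G1 t1 - G1 (- t1)) / t1 = -1 + (G2 t2 - G2 (- t2)) / t2 by lra.
  have : 2 * eps * (arcsine t1 / t1) = 2^-1 - 2 * eps * (arcsine t2 / t2).
    by rewrite -e /M; ring.
  by move=> -> ; rewrite mulrN; lra.
have cv := @continuous_partner R t1 t2.
apply: (@nondecreasing_of_derive R (fun u => H u + K u) (fun u => dH u + dK u) _ _ (ltW t10)).
  move=> u ut; have vt : 0 < v u < t2 := partner_itvoo t101 t201 ut.
  have su := sq t101 ut; have sv := sq t201 vt.
  have g0 := gap_gt0 t101 t201 ut.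
  have gi := gap_inv_le t101 t201 ut.
  split.
    have dv : is_derive u 1 v (- (t2 / t1)) := is_derive_partner t2 t101 u.
    have d1 : is_derive u 1 G1 (g1 u) by apply: dG1; lra.
    have d1' : is_derive u 1 (fun x => G1 (- x)) (- g1 (- u)).
      by apply: is_deriveNarg; apply: dG1; lra.
    have d2 : is_derive (v u) 1 G2 (g2 (v u)) by apply: dG2; lra.
    have d2' : is_derive (v u) 1 (fun x => G2 (- x)) (- g2 (- v u)).
      by apply: is_deriveNarg; apply: dG2; lra.
    have d2v := is_derive1_comp d2 dv.
    have d2v' := is_derive1_comp d2' dv.
    have u1 : -1 < u < 1 by have /andP[? ?] := t101; lra.
    have v1 : -1 < v u < 1 by have /andP[? ?] := t201; lra.
    have da := is_derive_arcsine u1.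
    have dav := is_derive1_comp (is_derive_arcsine v1) dv.
    have dd := @is_derive_balance R G1 (fun x => G1 (- x)) (fun x => G2 (v x))
      (fun x => G2 (- v x)) arcsine (fun x => arcsine (v x)) u _ _ _ _ _ _
      t1^-1 t2^-1 (2 * eps) d1 d1' d2v d2v' da dav.
    apply: (is_derive_eq dd); rewrite /dH /dK.
    move: (g1 u) (g1 (- u)) (g2 (v u)) (g2 (- v u)) (_^-1) (Num.sqrt (1 - v u ^+ 2))^-1
      => a b c d e f.
    by field; rewrite !gt_eqF.
  have [ut' vt'] : 0 <= u <= t1 /\ 0 <= v u <= t2 by split; lra.
  have n1 := claspX_gap t101 t201 ut'.
  have n2 : claspX t2 t1 (v u) * Num.sqrt (1 - v u ^+ 2) = v u * gap u (v u).
    by rewrite (claspX_gap t201 t101 vt') partnerK // gapC.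
  have sqp : (1 : R) ^+ 2 = 1 by ring.
  have sqm : (-1 : R) ^+ 2 = 1 by ring.
  have := strut u (-1) (-1) ut' sqm sqm; have := strut u (-1) 1 ut' sqm sqp.
  have := strut u 1 (-1) ut' sqp sqm; have := strut u 1 1 ut' sqp sqp.
  rewrite !mul1r !mulN1r -/v opprK.
  have neg w : dot w (vec3 0 0 (-1)) = - dot w (vec3 0 0 1) :> R.
    by rewrite dot_vec3_basis; ring.
  move=> h1 h2 h3 h4.
  have -> : dH u + dK u = (- ((Num.sqrt (1 - u ^+ 2) * - dot (x1 u) (vec3 0 0 1)
        - u * dot (x1 u) (vec3 1 0 0)) / Num.sqrt (1 - u ^+ 2)
      + (Num.sqrt (1 - u ^+ 2) * - dot (x1 (- u)) (vec3 0 0 1)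
        + u * dot (x1 (- u)) (vec3 1 0 0)) / Num.sqrt (1 - u ^+ 2))
    - ((Num.sqrt (1 - v u ^+ 2) * dot (x2 (v u)) (vec3 0 0 1)
        - v u * dot (x2 (v u)) (vec3 0 1 0)) / Num.sqrt (1 - v u ^+ 2)
      + (Num.sqrt (1 - v u ^+ 2) * dot (x2 (- v u)) (vec3 0 0 1)
        + v u * dot (x2 (- v u)) (vec3 0 1 0)) / Num.sqrt (1 - v u ^+ 2))
    + 2 * eps * ((Num.sqrt (1 - u ^+ 2))^-1 + (Num.sqrt (1 - v u ^+ 2))^-1)) / t1.
    by rewrite /dH /dK /g1 /g2 !neg !sqrrN; ring.
  apply: divr_ge0; last exact: ltW.
  apply: (strut_force_balance (py := dot (x1 u) (vec3 0 1 0)) (my := dot (x1 (- u)) (vec3 0 1 0))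
    (qx := dot (x2 (v u)) (vec3 1 0 0)) (nx := dot (x2 (- v u)) (vec3 1 0 0))
    g0 su sv (ltW eps0) n1 n2 gi).
  - by move: h1; congr (_ <= _); ring.
  - by move: h2; congr (_ <= _); ring.
  - by move: h3; congr (_ <= _); ring.
  - by move: h4; congr (_ <= _); ring.
have cK : continuous K.
  move=> u; apply: cvgM; first exact: cvg_cst.
  apply: cvgB; apply: cvgM; try exact: cvg_cst; first exact: continuous_arcsine.
  by apply: (@continuous_comp _ _ _ v arcsine); [exact: cv|exact: continuous_arcsine].
have cN (G : R -> R) (g : R -> R) : continuous G -> continuous g -> continuous (fun x => G (- g x)).
  move=> cG cg u; apply: (@continuous_comp _ _ _ (fun x => - g x) G); last exact: cG.
  by apply: cvgN; exact: cg.
apply: continuous_subspaceT => u; apply: cvgD; last exact: cK.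
apply: cvgD; apply: cvgM; try exact: cvg_cst.
  apply: cvgN; apply: cvgB; first exact: cG1.
  by apply: (cN G1 id) => //; move=> x; exact: cvg_id.
apply: cvgB; last exact: cN.
by apply: (@continuous_comp _ _ _ v G2); [exact: cv|exact: cG2].
Qed.
End Critical.

Theorem theorem3p1 (R : realType) (t1 t2 c1 c2 : R)
    (ht1 : 0 < t1 <= 1) (ht2 : 0 < t2 <= 1)
    (hseg1 : 0 <= seg1 t1 t2 c1) (hseg2 : 0 <= seg2 t1 t2 c2)
    (hT : avoids_obstacles (clasp t1 t2 c1 c2)) :
  generalized_link (clasp t1 t2 c1 c2) /\
  @strongly_critical R (clasp t1 t2 c1 c2) (clasp_weight t1 t2).
Proof.
split; first exact: clasp_generalized_link.
exact: clasp_strongly_critical.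
Qed.
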